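(* Let $X(t)=(x(t),y(t),z(t))$, $t\in[t_0,\infty)$, be a trajectory of the Lorenz system $\dot x=\sigma(y-x)$, $\dot y=x(\rho-z)-y$, $\dot z=xy-\beta z$ with parameter $\theta^*=(\sigma^*,\rho^*,\beta^* )$, satisfying $\sup_{t\ge t_0}\|X(t)\|\le\mathfrak K$. For $\theta=(\sigma,\rho,\beta)$ let $\tilde X_\theta(t)=(\tilde x(t;\theta),\tilde y(t;\theta),\tilde z(t;\theta))$ be the solution of the nudged system $$\dot{\tilde x}=\sigma(\tilde y-\tilde x)+\mu(\mathcal O-\tilde x),\qquad \dot{\tilde y}=\tilde x(\rho-\tilde z)-\tilde y,\qquad \dot{\tilde z}=\tilde x\tilde y-\beta\tilde z$$ driven by the observation $\mathcal O(t)$, with an arbitrary initial condition at $t_0$ independent of $\theta$. In (i) and (iii), $\mathcal O(t)=x(t)$. Let $U$ be a convex neighborhood of $\theta^*$, contained in $\{\sigma>0,\beta>0\}$, and assume $\mu>(|\sigma+\rho|+\mathfrak K)^2+\mathfrak K^2/\beta+\frac14-\sigma$ for all $\theta\in U$. For fixed $T>0$ set $$C(\theta)=C_\tau(\theta)=\frac1T\int_\tau^{\tau+T}|\mathcal O(t)-\tilde x(t;\theta)|^2\,dt,\qquad C_{\mathrm{lim}}(\theta)=\limsup_{\tau\to\infty}C_\tau(\theta).$$ (i) $C_{\mathrm{lim}}(\theta^* )=0$. (ii) Let $\mathcal O(t)=x(t)(1+\varepsilon(t))$, where $\varepsilon$ is the (bounded, continuous) observational error, and let $\tilde X_\theta$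 be the solution of the nudged system driven by this contaminated observation. Then $C_{\mathrm{lim}}(\theta^* )\le C_{\mathfrak K}\|\varepsilon\|_\infty^2$ for a constant $C_{\mathfrak K}$ (depending on $\mathfrak K$, $\theta^*$ and $\mu$, but not on $\varepsilon$). (iii) Let $\mathcal F(\theta)(t)=x(t)-\tilde x(t;\theta)$, regarded for each $\tau$ as a map $U\to L^2(\tau,\tau+T)$ with derivative $D\mathcal F$ with respect to $\theta$. Assume that there exists $\alpha>0$ such that $$\liminf_{\tau\to\infty}\|D\mathcal F(\theta^* )h\|_{L^2(\tau,\tau+T)}\ge\alpha\|h\|_{\mathbb R^3}\qquad\text{for all }h\in\mathbb R^3,$$ and $$\limsup_{\tau\to\infty}\|(D\mathcal F(\eta)-D\mathcal F(\theta^* ))h\|_{L^2(\tau,\tau+T)}\le\frac\alpha2\|h\|_{\mathbb R^3}\qquad\text{for all }\eta\in U,\ h\in\mathbb R^3 .$$ Then for every $\theta\in U$ $$\|\theta-\theta^*\|_{\mathbb R^3}\le\frac2\alpha\big(C_{\mathrm{lim}}(\theta)\big)^{1/2}.$$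
   Context: The $L^2(\tau,\tau+T)$ norm is taken with respect to the normalized measure $dt/T$, i.e. $\|f\|^2_{L^2(\tau,\tau+T)}=\frac1T\int_\tau^{\tau+T}|f(t)|^2dt$. $\|\varepsilon\|_\infty$ is the supremum norm on $[t_0,\infty)$. $\mathfrak K>0$ is a constant bounding the norm of the reference Lorenz trajectory. *)

(* Defs.v *)
From HB Require Import structures.
From mathcomp Require Import all_boot all_order all_algebra.
From mathcomp Require Import all_classical all_reals all_analysis.

Set Implicit Arguments.
Unset Strict Implicit.
Unset Printing Implicit Defensive.

Import Order.TTheory GRing.Theory Num.Theory.
Import numFieldNormedType.Exports.

Local Open Scope classical_set_scope.
Local Open Scope ring_scope.

Section LorenzNudging.
Context {R : realType}.

(* States (x, y, z) and parameters (sigma, rho, beta) are both row vectors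
   of R^3. *)
Definition xc (v : 'rV[R]_3) : R := v 0 0.
Definition yc (v : 'rV[R]_3) : R := v 0 1.
Definition zc (v : 'rV[R]_3) : R := v 0 2.

Definition sigma (theta : 'rV[R]_3) : R := theta 0 0.
Definition rho (theta : 'rV[R]_3) : R := theta 0 1.
Definition beta (theta : 'rV[R]_3) : R := theta 0 2.

(* The library norm on row vectors is the max norm. *)
Definition enorm (v : 'rV[R]_3) : R := Num.sqrt (\sum_(i < 3) v 0 i ^+ 2).

(* The derivatives are two-sided, so the equations are required on ]t0, +oo[
   only; together with continuity up to t0 this gives the one-sided equation
   at t0 (for a continuous observation O, in the nudged case). *)
Definition lorenz_solution (t0 : R) (theta : 'rV[R]_3) (X : R -> 'rV[R]_3) :=
  {within `[t0, +oo[, continuous X} /\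
  forall t, t0 < t ->
    [/\ is_derive t 1 (xc \o X) (sigma theta * (yc (X t) - xc (X t))),
        is_derive t 1 (yc \o X)
          (xc (X t) * (rho theta - zc (X t)) - yc (X t)) &
        is_derive t 1 (zc \o X)
          (xc (X t) * yc (X t) - beta theta * zc (X t))].

Definition nudged_solution (t0 mu : R) (O : R -> R) (theta : 'rV[R]_3)
    (X : R -> 'rV[R]_3) :=
  {within `[t0, +oo[, continuous X} /\
  forall t, t0 < t ->
    [/\ is_derive t 1 (xc \o X)
          (sigma theta * (yc (X t) - xc (X t)) + mu * (O t - xc (X t))),
        is_derive t 1 (yc \o X)
          (xc (X t) * (rho theta - zc (X t)) - yc (X t)) &
        is_derive t 1 (zc \o X)
          (xc (X t) * yc (X t) - beta theta * zc (X t))].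

Definition nudged_family (t0 mu : R) (O : R -> R) (U : set 'rV[R]_3)
    (Xt : 'rV[R]_3 -> R -> 'rV[R]_3) :=
  (forall theta, U theta -> nudged_solution t0 mu O theta (Xt theta)) /\
  exists X0, forall theta, U theta -> Xt theta t0 = X0.

Definition mean_sq (T tau : R) (f : R -> R) : \bar R :=
  (T^-1%:E * \int[lebesgue_measure]_(t in `[tau, (tau + T)%R]) (f t ^+ 2)%:E)%E.

(* Norm of L^2(tau, tau + T) for the normalized measure dt / T. *)
Definition L2norm (T tau : R) (f : R -> R) : \bar R := sqrte (mean_sq T tau f).

Definition in_L2 (T tau : R) (f : R -> R) : Prop :=
  measurable_fun `[tau, (tau + T)%R] f /\ (L2norm T tau f < +oo)%E.

(* L is the Frechet derivative at eta of F : U -> L^2(tau, tau + T), taken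
   relatively to U. Elements of L^2 are represented by functions, so linearity
   of L : R^3 -> L^2 is an almost-everywhere equality; boundedness of L is
   automatic in finite dimension. *)
Definition is_L2_derivative (T tau : R) (U : set 'rV[R]_3)
    (F : 'rV[R]_3 -> R -> R) (eta : 'rV[R]_3) (L : 'rV[R]_3 -> R -> R) : Prop :=
  [/\ forall h, in_L2 T tau (L h),
      forall (a : R) (h k : 'rV[R]_3),
        {ae lebesgue_measure, forall t, t \in `[tau, tau + T] ->
          L (a *: h + k) t = a * L h t + L k t} &
      forall e : R, 0 < e -> \forall theta \near within U (nbhs eta),
        (L2norm T tau (fun t => (F theta t - F eta t - L (theta - eta) t)%R)
          <= (e * enorm (theta - eta))%:E)%E].

Definition cost (T : R) (O : R -> R) (Xt : 'rV[R]_3 -> R -> 'rV[R]_3)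
    (theta : 'rV[R]_3) (tau : R) : \bar R :=
  mean_sq T tau (fun t => O t - xc (Xt theta t)).

Definition cost_lim (T : R) (O : R -> R) (Xt : 'rV[R]_3 -> R -> 'rV[R]_3)
    (theta : 'rV[R]_3) : \bar R :=
  limf_esup (cost T O Xt theta) +oo_R.

Definition sup_norm (t0 : R) (f : R -> R) : R :=
  sup [set `|f t| | t in `[t0, +oo[].

End LorenzNudging.

(* Main.v *)
Require Import Defs.
From HB Require Import structures.
From mathcomp Require Import all_boot all_order all_algebra.
From mathcomp Require Import all_classical all_reals all_analysis.
From mathcomp Require Import measurable_realfun ring lra.

(* For (i) and (ii), the squared distance E between the nudged and the reference
   trajectory satisfies E' <= - c E + C |eps|^2, because the lower bound on mu
   absorbs the indefinite terms.

   For (iii), the hypotheses bound D F pointwise in the parameter only, so the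
   passage to the limit under the integral over the segment from thetas to theta
   requires a Lipschitz bound of F that is uniform in tau. Such a bound holds
   on {rho >= 0}: for Q = y^2 + (z - rho)^2 one has the identity
   y^2 + beta (z - rho / 2)^2 = beta rho^2 / 4 - Q' / 2, so the variational
   equation contracts on average and becomes contracting at every time once
   the energy is multiplied by exp (a Q + b e^(- t)) for suitable a and b.
   The hypotheses force rho > 0 at thetas and rho >= 0 on U: at an interior
   parameter of U where y and z tend to 0 (as happens if rho = 0, or at thetas
   if rho <= 0 there) the derivative in the direction beta tends to 0, whereas it
   must stay above alpha / 2. The conclusion then follows from Fatou's lemma,
   applied to the derivatives in s of the projections of F on the vector
   D F (thetas) (theta - thetas) along the segment. *)

Set Implicit Arguments.
Unset Strict Implicit.
Unset Printing Implicit Defensive.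

Import Order.TTheory GRing.Theory Num.Theory.
Import numFieldNormedType.Exports.

Local Open Scope classical_set_scope.
Local Open Scope ring_scope.

(** * Differential inequalities *)

(** The estimate behind (i) and (ii) takes its coefficients along the reference trajectory, the only
    one that [K] bounds. Between two nudged trajectories with different parameters this bound is
    lost, and what survives of the condition on [mu] is [(sigma + rho) ^+ 2 + 4^-1 <= sigma + mu].
    With [N = (sigma + mu) / sigma] it gives [4 * rho <= N]: after division of [y] and [z] by [N]
    the parameter [rho / N] is at most 1/4, small enough for the couplings to stay below the damping
    on average. The constants of the weighted energy come from this budget.

    The closeness of the derivatives holds for [tau] beyond a threshold that depends on the
    parameter; the Lipschitz bound is the common bound on the integrands that lets Fatou's lemma
    overcome this. The derivative comes with no continuity or measurability in the parameter, hence
    a fundamental theorem of calculus for Lipschitz functions. *)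

Section differential_inequalities.
Context {R : realType}.
Implicit Types (f g df dg : R -> R) (t a b c : R).

(** Pairs of a function and a formula for its derivative, closed under sums, products and [expR]:
    the derivative of an energy is assembled by these rules, then brought to the wanted form by
    [ring] through [evolves_eq]. *)
Definition evolves (t0 : R) f df :=
  {within `[t0, +oo[, continuous f} /\
  forall t, t0 < t -> is_derive t 1 f (df t).

Lemma evolves_eq (t0 : R) f df dg : evolves t0 f df ->
  (forall t, t0 < t -> df t = dg t) -> evolves t0 f dg.
Proof.
by move=> [cf hf] e; split=> // t t0t; rewrite -e//; exact: hf.
Qed.

Lemma evolves_cst (t0 : R) c : evolves t0 (fun=> c) (fun=> 0).
Proof. by split=> [|t _]; [move=> s; exact: cst_continuous|exact: is_derive_cst]. Qed.

Lemma evolvesD (t0 : R) f g df dg : evolves t0 f df -> evolves t0 g dg ->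
  evolves t0 (fun t => f t + g t) (fun t => df t + dg t).
Proof.
move=> [cf hf] [cg hg]; split=> [s|t t0t].
  by apply: continuousD; [exact: cf|exact: cg].
exact: (is_deriveD (hf _ t0t) (hg _ t0t)).
Qed.

Lemma evolvesM (t0 : R) f g df dg : evolves t0 f df -> evolves t0 g dg ->
  evolves t0 (fun t => f t * g t) (fun t => df t * g t + f t * dg t).
Proof.
move=> [cf hf] [cg hg]; split=> [s|t t0t].
  by apply: continuousM; [exact: cf|exact: cg].
have := is_deriveM (hf _ t0t) (hg _ t0t) => h.
by apply: is_derive_eq h _; rewrite addrC [_ *: df t]mulrC.
Qed.

Lemma evolvesZ (t0 : R) c f df : evolves t0 f df ->
  evolves t0 (fun t => c * f t) (fun t => c * df t).
Proof.
move=> hf; apply: evolves_eq (evolvesM (evolves_cst t0 c) hf) _ => t _.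
by rewrite mul0r add0r.
Qed.

Lemma evolvesB (t0 : R) f g df dg : evolves t0 f df -> evolves t0 g dg ->
  evolves t0 (fun t => f t - g t) (fun t => df t - dg t).
Proof.
move=> [cf hf] [cg hg]; split=> [s|t t0t].
  by apply: continuousB; [exact: cf|exact: cg].
exact: (is_deriveB (hf _ t0t) (hg _ t0t)).
Qed.

Lemma evolvesX2 (t0 : R) f df : evolves t0 f df ->
  evolves t0 (fun t => f t ^+ 2) (fun t => 2 * (f t * df t)).
Proof.
move=> hf; have := evolvesM hf hf.
rewrite (_ : (fun t => f t * f t) = (fun t => f t ^+ 2)); last first.
  by apply/funext => t; rewrite expr2.
by move=> h; apply: evolves_eq h _ => t _; ring.
Qed.

Lemma evolves_expR (t0 : R) f df : evolves t0 f df ->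
  evolves t0 (fun t => expR (f t)) (fun t => expR (f t) * df t).
Proof.
move=> [cf hf]; split=> [s|t t0t].
  by apply: continuous_comp; [exact: cf|exact: continuous_expR].
have := hf _ t0t => ?; exact: is_derive1_comp.
Qed.

Lemma evolves_exp_decay (t0 : R) c (C : R) :
  evolves t0 (fun t => C * expR (- c * (t - t0)))
             (fun t => - c * (C * expR (- c * (t - t0)))).
Proof.
have h : evolves t0 (fun t => - c * (t - t0)) (fun=> - c).
  split=> [|t _].
    apply: continuous_subspaceT => u.
    apply: (@continuousM _ _ (fun=> - c) (fun t => t - t0)).
      exact: cst_continuous.
    by apply: continuousB; [exact: cvg_id|exact: cst_continuous].
  rewrite (_ : (fun t => _) = - c *: (id - cst t0)) //.
  by apply: is_derive_eq; rewrite subr0; exact: mulr1.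
by apply: evolves_eq (evolvesZ C (evolves_expR h)) _ => t _; ring.
Qed.

Lemma expR_decay_le1 (t0 : R) c t : 0 <= c -> t0 <= t -> expR (- c * (t - t0)) <= 1.
Proof.
by move=> c0 t0t; rewrite -expR0 ler_expR mulNr oppr_le0 mulr_ge0 ?subr_ge0.
Qed.

Lemma evolves_nonincr (t0 : R) f df : evolves t0 f df ->
  (forall t, t0 < t -> df t <= 0) ->
  forall t, t0 <= t -> f t <= f t0.
Proof.
move=> [cf hd] hle t; rewrite le_eqVlt => /predU1P[<-//|t0t].
have cf' : {within `[t0, t], continuous f}.
  apply: continuous_subspaceW cf => x /=; rewrite !in_itv/= => /andP[-> _].
  by [].
have [|c /[!in_itv]/= /andP[t0c _] e] := @MVT R f df _ _ t0t _ cf'.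
  by move=> x /[!in_itv]/= /andP[t0x _]; exact: hd.
by rewrite -subr_le0 e mulr_le0_ge0 ?hle// subr_ge0 ltW.
Qed.

Lemma gronwall (t0 : R) c f df : evolves t0 f df ->
  (forall t, t0 < t -> df t <= - c * f t) ->
  forall t, t0 <= t -> f t <= f t0 * expR (- c * (t - t0)).
Proof.
move=> hf hle t t0t.
have := @evolves_nonincr _ _ _ (evolvesM hf (evolves_exp_decay t0 (- c) 1)) _ t t0t.
rewrite subrr mulr0 expR0 !mulr1 opprK mul1r mulNr expRN.
have e0 : 0 < expR (c * (t - t0)) by exact: expR_gt0.
move=> H; rewrite -ler_pdivrMr ?invr_gt0// invrK; apply: H => s t0s.
have := hle _ t0s; rewrite mul1r.
have : 0 < expR (c * (s - t0)) by exact: expR_gt0.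
move: (expR _) => x x0 H.
rewrite (_ : _ + _ = (df s + c * f s) * x); last by ring.
by rewrite mulr_le0_ge0 ?(ltW x0)//; lra.
Qed.

(** [D / c] is the equilibrium of [f' = - c * f + D], and [f - D / c] satisfies the homogeneous
    inequality. *)
Lemma gronwall_cst (t0 : R) c (D : R) f df : 0 < c -> evolves t0 f df ->
  (forall t, t0 < t -> df t <= - c * f t + D) ->
  forall t, t0 <= t -> f t <= (f t0 - D / c) * expR (- c * (t - t0)) + D / c.
Proof.
move=> c0 hf hle t t0t.
rewrite -lerBlDr.
apply: (gronwall (evolvesB hf (evolves_cst t0 (D / c)))) t0t => s t0s.
rewrite subr0 (le_trans (hle _ t0s))// le_eqVlt; apply/orP; left; apply/eqP.
by field; rewrite gt_eqF.
Qed.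

(** Comparison with [D / c] times the decaying exponential, a supersolution because [b <= c]: the
    rate [2 * c] pays once for the forcing and once for the decay of the comparison function. *)
Lemma gronwall_decay (t0 : R) c b (D C : R) f df : 0 <= D -> 0 <= C -> 0 < b -> b <= c ->
  evolves t0 f df -> f t0 <= 0 ->
  (forall t, t0 < t ->
     df t <= - (2 * c) * f t + D * (C * expR (- b * (t - t0)))) ->
  forall t, t0 <= t -> f t <= D / c * (C * expR (- b * (t - t0))).
Proof.
move=> D0 C0 b0 bc hf f0 hle t t0t.
have c0 : 0 < c by lra.
rewrite -subr_le0.
apply: le_trans (gronwall (evolvesB hf (evolvesZ (D / c)
  (evolves_exp_decay t0 b C))) (c := 2 * c) _ t0t) _ => [s t0s|].
  apply: le_trans (lerB (hle _ t0s) (lexx _)) _.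
  have : 0 <= C * expR (- b * (s - t0)) by rewrite mulr_ge0 ?expR_ge0.
  move: (C * _) => q q0; rewrite -subr_ge0.
  rewrite (_ : _ - _ = D / c * (c - b) * q); last by field; rewrite gt_eqF.
  by rewrite !mulr_ge0 ?invr_ge0 ?subr_ge0// ltW.
rewrite subrr mulr0 expR0 mulr1 mulr_le0_ge0 ?expR_ge0//.
by rewrite subr_le0 (le_trans f0)// !mulr_ge0 ?invr_ge0// ltW.
Qed.

End differential_inequalities.

(** * Energy estimates for the nudged system *)

Section energy_forms.
Context {R : realType}.

(* [U] is the rescaled first component of a difference of two solutions, and
   [y ^+ 2 + b * (z * (z - p))] is [- 1 / 2] times the derivative of
   [y ^+ 2 + (z - p) ^+ 2] along the flow. *)
Lemma rescaled_form_le (p b m q y z U v w : R) :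
  0 <= p -> p <= 4^-1 -> 0 < b -> 4^-1 <= m -> 0 <= q ->
  y ^+ 2 + (z - p) ^+ 2 <= Num.max 1 b * p ^+ 2 + q ->
  - U ^+ 2 + (1 + p - z) * U * v - v ^+ 2 + y * U * w - b * w ^+ 2 <=
  (- (3 / 100 * Num.min 1 b)
   + 5 / 4 * (Num.min 1 b / b) * (y ^+ 2 + b * (z * (z - p))) + 5 / 2 * q) *
  (m^-1 * U ^+ 2 + v ^+ 2 + w ^+ 2).
Proof.
move=> p0 p4 b0 m4 q0.
have m0 : 0 < m by apply: lt_le_trans m4; rewrite invr_gt0.
have im0 : 0 <= m^-1 by rewrite invr_ge0 ltW.
have im4 : m^-1 <= 4 by rewrite -[leRHS]invrK lef_pV2 ?posrE ?invr_gt0.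
have U0 := sqr_ge0 U; have v0 := sqr_ge0 v; have w0 := sqr_ge0 w.
have p2 : p ^+ 2 <= 16^-1.
  rewrite expr2 (le_trans (ler_pM p0 p0 p4 p4))//.
  by rewrite -invfM -natrM lexx.
(* With weight 2/5 here and weights of sum 2/5 for the squares in [U] of each case below, completing
   squares spends 4/5 of the damping [U ^+ 2]. The remaining 1/5 must dominate
   [4 * (3 / 100 + 5 / 256)], where 4 bounds [m^-1] and 5/256 bounds [5 / 16 * p ^+ 2]. *)
have h1 := sqr_ge0 (U - 5 / 4 * v).
have mU0 : 0 <= m^-1 * U ^+ 2 by rewrite mulr_ge0.
have mU4 : m^-1 * U ^+ 2 <= 4 * U ^+ 2 by rewrite ler_wpM2r.
have E0 : 0 <= m^-1 * U ^+ 2 + v ^+ 2 + w ^+ 2 by rewrite !addr_ge0.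
have yE : 0 <= y ^+ 2 * (m^-1 * U ^+ 2 + v ^+ 2 + w ^+ 2 - w ^+ 2).
  by rewrite mulr_ge0 ?sqr_ge0// addrK addr_ge0.
have qE1 : 0 <= q * (m^-1 * U ^+ 2 + v ^+ 2 + w ^+ 2 - w ^+ 2).
  by rewrite mulr_ge0// addrK addr_ge0.
have qE2 : 0 <= q * (m^-1 * U ^+ 2 + v ^+ 2 + w ^+ 2 - v ^+ 2).
  rewrite mulr_ge0// (_ : _ - _ = m^-1 * U ^+ 2 + w ^+ 2); last by ring.
  by rewrite addr_ge0.
have pE : 0 <= (16^-1 - p ^+ 2) * (m^-1 * U ^+ 2 + v ^+ 2 + w ^+ 2).
  by rewrite mulr_ge0 ?subr_ge0.
have pv : 0 <= (16^-1 - p ^+ 2) * v ^+ 2 by rewrite mulr_ge0 ?subr_ge0.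
have qE0 : 0 <= q * (m^-1 * U ^+ 2 + v ^+ 2 + w ^+ 2) by rewrite mulr_ge0.
have [b1|b1] := leP b 1.
- rewrite mul1r divff ?gt_eqF// => HQ.
  have h2 := sqr_ge0 (U - 5 / 2 * (p - z) * v).
  have h3 := sqr_ge0 (U - 5 / 2 * y * w).
  (* For small [b] the term [b * (z - p / 2) ^+ 2] is too weak to control [z], so the bound on the
     energy is spent on [(z - p) ^+ 2]. *)
  have dv : 0 <= (p ^+ 2 + q - (y ^+ 2 + (z - p) ^+ 2) + y ^+ 2) * v ^+ 2.
    by rewrite mulr_ge0// addr_ge0 ?subr_ge0 ?sqr_ge0.
  have bE : b * (m^-1 * U ^+ 2 + v ^+ 2) <= 4 * U ^+ 2 + v ^+ 2.
    rewrite (@le_trans _ _ (1 * (m^-1 * U ^+ 2 + v ^+ 2)))//.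
      by rewrite ler_wpM2r// addr_ge0.
    by rewrite mul1r lerD2r.
  have bpE : 0 <= b * (16^-1 - p ^+ 2) * (m^-1 * U ^+ 2 + v ^+ 2 + w ^+ 2).
    by rewrite -mulrA mulr_ge0// ltW.
  have zE : 0 <= b * (z - p / 2) ^+ 2 * (m^-1 * U ^+ 2 + v ^+ 2 + w ^+ 2).
    by apply: mulr_ge0 E0; rewrite mulr_ge0 ?sqr_ge0// ltW.
  have bw : 0 <= b * w ^+ 2 by rewrite mulr_ge0// ltW.
  lra.
- rewrite mul1r => HQ.
  have ib0 : 0 < b^-1 by rewrite invr_gt0.
  rewrite (_ : _ * b^-1 * _ = 5 / 4 * (b^-1 * y ^+ 2 + z * (z - p))); last first.
    by field; rewrite gt_eqF.
  have h2 := sqr_ge0 (U - 5 / 2 * (p / 2 - z) * v).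
  have h3 := sqr_ge0 (U - 5 * y * w).
  have h4 := sqr_ge0 (U - 5 / 2 * p * v).
  (* For large [b] it is [b^-1 * y ^+ 2] that is too weak: the bound on the energy is spent on
     [y ^+ 2], and the damping [b * w ^+ 2] absorbs the part with [p]. *)
  have yw : 0 <= (b * p ^+ 2 + q - (y ^+ 2 + (z - p) ^+ 2) + (z - p) ^+ 2) * w ^+ 2.
    by rewrite mulr_ge0// addr_ge0 ?subr_ge0 ?sqr_ge0.
  have bpw : 0 <= b * (16^-1 - p ^+ 2) * w ^+ 2.
    by rewrite mulr_ge0// mulr_ge0 ?subr_ge0// ltW// (lt_trans _ b1).
  have bw : 0 <= (b - 1) * w ^+ 2 by rewrite mulr_ge0// subr_ge0 ltW.
  have yE' : 0 <= b^-1 * y ^+ 2 * (m^-1 * U ^+ 2 + v ^+ 2 + w ^+ 2).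
    by apply: mulr_ge0 E0; rewrite mulr_ge0 ?sqr_ge0// ltW.
  have zE : 0 <= (z - p / 2) ^+ 2 * (m^-1 * U ^+ 2 + w ^+ 2).
    by rewrite mulr_ge0 ?sqr_ge0// addr_ge0.
  lra.
Qed.

End energy_forms.

Section nudged_estimates.
Context {R : realType}.

(** The Lorenz trajectory is the special case where the observation is [x] itself and the nudging
    term vanishes, so the energy identities below serve for both systems. *)
Definition nudged_flow (t0 mu : R) (O : R -> R) (s r b : R) (x y z : R -> R) :=
  [/\ evolves t0 x (fun t => s * (y t - x t) + mu * (O t - x t)),
      evolves t0 y (fun t => x t * (r - z t) - y t) &
      evolves t0 z (fun t => x t * y t - b * z t)].

Lemma min1_gt0 (b : R) : 0 < b -> 0 < Num.min 1 b.
Proof. by move=> b0; rewrite lt_min ltr01. Qed.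

(** Centring [z] at [r] cancels every term with [x]: the identity sees neither the observation nor
    the nudging. *)
Lemma energy_yz_derivative (t0 mu : R) O s r b x y z :
  nudged_flow t0 mu O s r b x y z ->
  evolves t0 (fun t => y t ^+ 2 + (z t - r) ^+ 2)
    (fun t => - 2 * (y t ^+ 2 + b * (z t * (z t - r)))).
Proof.
move=> [_ hy hz].
have := evolvesD (evolvesX2 hy) (evolvesX2 (evolvesB hz (evolves_cst t0 r))).
by move=> h; apply: evolves_eq h _ => t _; ring.
Qed.

Lemma energy_yz_le (t0 mu : R) O s r b x y z :
  0 < b -> nudged_flow t0 mu O s r b x y z ->
  forall t, t0 <= t -> y t ^+ 2 + (z t - r) ^+ 2 <=
    Num.max 1 b * r ^+ 2 +
    (y t0 ^+ 2 + (z t0 - r) ^+ 2) * expR (- Num.min 1 b * (t - t0)).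
Proof.
move=> b0 hX t t0t.
have mb0 := min1_gt0 b0.
have Q0 : 0 <= y t0 ^+ 2 + (z t0 - r) ^+ 2 by rewrite addr_ge0 ?sqr_ge0.
have M0 : 0 <= Num.max 1 b * r ^+ 2 by rewrite mulr_ge0 ?sqr_ge0// le_max ler01.
apply: le_trans (gronwall_cst mb0 (D := Num.min 1 b * (Num.max 1 b * r ^+ 2))
  (energy_yz_derivative hX) _ t0t) _ => [u t0u|].
  (* By [2 * (z * (z - r)) = z ^+ 2 + (z - r) ^+ 2 - r ^+ 2] the energy decays at rate [Num.min 1 b]
     up to the forcing [b * r ^+ 2]; the equilibrium level follows from
     [Num.min 1 b * Num.max 1 b = b]. *)
  have y0 := sqr_ge0 (y u); have z0 := sqr_ge0 (z u - r).
  have [b1|b1] := leP b 1.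
    have h := sqr_ge0 (z u); have : 0 <= (1 - b) * y u ^+ 2.
      by rewrite mulr_ge0// subr_ge0.
    have : 0 <= b * z u ^+ 2 by rewrite mulr_ge0// ltW.
    nra.
  have : 0 <= (b - 1) * (z u - r) ^+ 2 by rewrite mulr_ge0// subr_ge0 ltW.
  have : 0 <= b * z u ^+ 2 by rewrite mulr_ge0 ?sqr_ge0// ltW// (lt_trans _ b1).
  lra.
rewrite [Num.min 1 b * _]mulrC mulfK ?gt_eqF// addrC lerD2l.
by rewrite ler_wpM2r ?expR_ge0// lerBlDr lerDl.
Qed.

(** [x] relaxes at rate [s + mu] towards [(s * y + mu * O) / (s + mu)], so it inherits a bound from
    [y] and the observation. *)
Lemma observed_coordinate_le (t0 mu : R) O s r b x y z (A : R) :
  0 < s + mu -> nudged_flow t0 mu O s r b x y z ->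
  (forall t, t0 < t -> (s * y t + mu * O t) ^+ 2 <= A) ->
  forall t, t0 <= t -> x t ^+ 2 <= x t0 ^+ 2 + A / (s + mu) ^+ 2.
Proof.
move=> m0 [hx _ _] hA t t0t.
have m20 : 0 < (s + mu) ^+ 2 by rewrite exprn_gt0.
have A0 : 0 <= A / (s + mu) ^+ 2.
  rewrite divr_ge0 ?(ltW m20)//; apply: le_trans (hA (t + 1) _); first exact: sqr_ge0.
  by rewrite (le_lt_trans t0t)// ltrDl.
apply: le_trans (gronwall_cst m0 (D := A / (s + mu)) (evolvesX2 hx) _ t0t) _.
  move=> u t0u; have := hA _ t0u.
  set f := s * y u + mu * O u => hf.
  rewrite (_ : s * _ + _ = f - (s + mu) * x u); last by rewrite /f; ring.
  have h : 0 <= (s + mu) * ((s + mu)^-1 * f - x u) ^+ 2 by rewrite mulr_ge0 ?sqr_ge0// ltW.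
  have h' : f ^+ 2 / (s + mu) <= A / (s + mu) by rewrite ler_pM2r ?invr_gt0.
  have e : (s + mu) * ((s + mu)^-1 * f - x u) ^+ 2 =
    f ^+ 2 / (s + mu) - 2 * f * x u + (s + mu) * x u ^+ 2.
    by field; rewrite gt_eqF.
  lra.
rewrite -mulrA -invfM -expr2.
have e0 := expR_ge0 (- (s + mu) * (t - t0)).
have e1 := expR_decay_le1 (ltW m0) t0t.
by rewrite lerD2r (le_trans (y := x t0 ^+ 2 * expR (- (s + mu) * (t - t0))))//
  ?ler_wpM2r ?lerBlDr ?lerDl// ler_piMr ?sqr_ge0.
Qed.

(* The coefficients are evaluated along the first solution, the forcing terms
   along the second one. *)
Lemma energy_difference_derivative (t0 mu : R) k
    O s r b x y z O' s' r' b' x' y' z' :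
  nudged_flow t0 mu O s r b x y z -> nudged_flow t0 mu O' s' r' b' x' y' z' ->
  evolves t0
    (fun t => k * (x' t - x t) ^+ 2 + (y' t - y t) ^+ 2 + (z' t - z t) ^+ 2)
    (fun t => 2 *
      ((- (k * (s + mu)) * (x' t - x t) ^+ 2
        + (k * s + r - z t) * (x' t - x t) * (y' t - y t) - (y' t - y t) ^+ 2
        + y t * (x' t - x t) * (z' t - z t) - b * (z' t - z t) ^+ 2)
       + (k * ((s' - s) * (y' t - x' t) + mu * (O' t - O t)) * (x' t - x t)
          + (r' - r) * x' t * (y' t - y t) - (b' - b) * z' t * (z' t - z t)))).
Proof.
move=> [hx hy hz] [hx' hy' hz'].
have := evolvesD (evolvesD (evolvesZ k (evolvesX2 (evolvesB hx' hx)))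
  (evolvesX2 (evolvesB hy' hy))) (evolvesX2 (evolvesB hz' hz)).
by move=> h; apply: evolves_eq h _ => t _; ring.
Qed.

End nudged_estimates.

(** * Lipschitz dependence on the parameters, uniformly in time *)

Section nudged_lipschitz.
Context {R : realType}.

(* Weighting the energy of the difference by the exponential of the (bounded)
   function [P] turns a decay that holds only on average into a decay that
   holds at every time. *)
Lemma energy_difference_le (t0 mu : R) O s r b x y z s' r' b' x' y' z' S :
  0 < s -> 0 <= r -> 0 < b -> (s + r) ^+ 2 + 4^-1 <= s + mu ->
  nudged_flow t0 mu O s r b x y z -> nudged_flow t0 mu O s' r' b' x' y' z' ->
  x' t0 = x t0 -> y' t0 = y t0 -> z' t0 = z t0 ->
  let k := (s + mu) / s ^+ 2 in
  let m := Num.min 1 b in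
  let Q := y t0 ^+ 2 + (z t0 - r) ^+ 2 in
  (forall t, t0 < t -> k * ((s' - s) * (y' t - x' t)) ^+ 2
     + ((r' - r) * x' t) ^+ 2 + ((b' - b) * z' t) ^+ 2 <= S) ->
  forall t, t0 <= t ->
  k * (x' t - x t) ^+ 2 + (y' t - y t) ^+ 2 + (z' t - z t) ^+ 2 <=
  expR (5 / 4 * (Num.max 1 b * r ^+ 2 + Q) + 5 / m * Q) * S / (3 / 100 * m) ^+ 2.
Proof.
move=> s0 r0 b0 hm hX hX' ex ey ez k m Q hS t t0t.
(* The weight [k] is chosen so that [k * s = N] and [k * (s + mu) = N ^+ 2]: in the variable
   [N * (x' - x)] the quadratic form becomes that of [rescaled_form_le]. *)
pose N := (s + mu) / s.
have m0 : 0 < m := min1_gt0 b0.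
have M0 : 0 < s + mu by apply: lt_le_trans hm; rewrite ltr_wpDl ?sqr_ge0 ?invr_gt0.
(* From [4 * s * r <= (s + r) ^+ 2 <= s + mu]. *)
have N4 : 4 * r <= N.
  rewrite /N ler_pdivlMr//; have := sqr_ge0 (s - r); nra.
have N1 : 1 <= N.
  rewrite /N ler_pdivlMr// mul1r; have := sqr_ge0 (s - 2^-1); nra.
have N0 : 0 < N := lt_le_trans ltr01 N1.
have kE : k = N / s by rewrite /k /N; field; rewrite gt_eqF.
have k0 : 0 < k by rewrite kE divr_gt0.
have kMN : k * (s + mu) = N ^+ 2.
  by rewrite kE /N; field; rewrite gt_eqF.
have ksN : k * s = N by rewrite kE mulfVK ?gt_eqF.
have Q0 : 0 <= Q by rewrite addr_ge0 ?sqr_ge0.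
(* [A] and [B] are dictated by [rescaled_form_le]: minus half the derivative of [P] must reproduce
   the terms with 5/4 and 5/2 of its right-hand side. *)
pose A := 5 / 4 * (m / b) / N ^+ 2.
pose B := 5 / m / N ^+ 2.
have N20 : 0 < N ^+ 2 by rewrite exprn_gt0.
have A0 : 0 <= A by rewrite !mulr_ge0 ?invr_ge0// ltW.
have B0 : 0 <= B by rewrite !mulr_ge0 ?invr_ge0// ltW.
have N21 : (N ^+ 2)^-1 <= 1 by rewrite invf_le1// expr_ge1// ltW.
have mb : m / b <= 1 by rewrite ler_pdivrMr// mul1r ge_min lexx orbT.
have A1 : A <= 5 / 4.
  rewrite /A -mulrA ler_piMr// mulr_ile1// ?invr_ge0 ?divr_ge0// ltW//.
have B1 : B <= 5 / m by rewrite /B ler_piMr// divr_ge0// ltW.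
pose q u := Q * expR (- m * (u - t0)).
pose P u := A * (y u ^+ 2 + (z u - r) ^+ 2) + B * q u.
have hP := evolvesD (evolvesZ A (energy_yz_derivative hX))
  (evolvesZ B (evolves_exp_decay t0 m Q)).
have q0 u : 0 <= q u by rewrite mulr_ge0 ?expR_ge0.
have P0 u : 0 <= P u.
  by rewrite addr_ge0// mulr_ge0// addr_ge0 ?sqr_ge0.
have qQ u : t0 <= u -> q u <= Q.
  by move=> t0u; rewrite /q ler_piMr// expR_decay_le1// ltW.
have hQ u : t0 <= u -> y u ^+ 2 + (z u - r) ^+ 2 <= Num.max 1 b * r ^+ 2 + q u.
  exact: (energy_yz_le b0 hX).
pose Pmax := 5 / 4 * (Num.max 1 b * r ^+ 2 + Q) + 5 / m * Q.
have PP u : t0 <= u -> P u <= Pmax.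
  move=> t0u; rewrite lerD// ler_pM ?addr_ge0 ?sqr_ge0//; last exact: qQ.
  by rewrite (le_trans (hQ _ t0u))// lerD2l qQ.
have hE := energy_difference_derivative k hX hX'.
have hf := evolvesM hE (evolves_expR hP).
have S0 : 0 <= S.
  apply: le_trans (hS (t + 1) _); last by rewrite (le_lt_trans t0t)// ltrDl.
  by rewrite !addr_ge0 ?sqr_ge0// mulr_ge0 ?sqr_ge0// ltW.
set al := 3 / 100 * m.
have al0 : 0 < al by rewrite mulr_gt0// divr_gt0.
have := gronwall_cst al0 hf (D := expR Pmax * (S / al)) _ t0t.
rewrite ex ey ez !subrr expr0n/= mulr0 !addr0 mul0r sub0r -/q.
set E := k * _ + _ + _; move=> H.
have E0 : 0 <= E by rewrite !addr_ge0 ?sqr_ge0// mulr_ge0 ?sqr_ge0// ltW.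
have Ef : E <= E * expR (P t) by rewrite ler_peMr// -expR0 ler_expR.
apply: le_trans Ef _; apply: le_trans (H _) _; last first.
  rewrite mulNr (_ : expR Pmax * (S / al) / al = expR Pmax * S / al ^+ 2); last first.
    by field; rewrite gt_eqF.
  by rewrite gerDr oppr_le0 !mulr_ge0 ?expR_ge0// invr_ge0 exprn_ge0// ltW.
move=> {H E E0} u t0u.
set dx := x' u - x u; set dy := y' u - y u; set dz := z' u - z u.
have hF := hS u t0u.
have hPu := PP u (ltW t0u).
set F1 := (s' - s) * _ in hF *; set F2 := (r' - r) * _ in hF *.
set F3 := (b' - b) * _ in hF *.
have Hform : - (k * (s + mu)) * dx ^+ 2 + (k * s + r - z u) * dx * dy - dy ^+ 2
    + y u * dx * dz - b * dz ^+ 2 <=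
  (- al - 2^-1 * (A * (- 2 * (y u ^+ 2 + b * (z u * (z u - r)))) +
                  B * (- m * q u))) * (k * dx ^+ 2 + dy ^+ 2 + dz ^+ 2).
  have := @rescaled_form_le R (r / N) b (s + mu) (q u / N ^+ 2) (y u / N) (z u / N)
    (N * dx) dy dz.
  rewrite (_ : (s + mu)^-1 * (N * dx) ^+ 2 = k * dx ^+ 2); last first.
    by rewrite kE /N; field; rewrite !gt_eqF.
  rewrite (_ : - al - _ = - (3 / 100 * m) + 5 / 4 * (m / b) *
    ((y u / N) ^+ 2 + b * (z u / N * (z u / N - r / N))) + 5 / 2 * (q u / N ^+ 2));
    last by rewrite /al /A /B; field; rewrite !gt_eqF.
  rewrite (_ : - (k * (s + mu)) * _ + _ - _ + _ - _ =
    - (N * dx) ^+ 2 + (1 + r / N - z u / N) * (N * dx) * dy - dy ^+ 2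
    + y u / N * (N * dx) * dz - b * dz ^+ 2); last first.
    by rewrite kMN ksN; field; rewrite !gt_eqF.
  apply.
  - by rewrite divr_ge0// ltW.
  - by rewrite ler_pdivrMr// ler_pdivlMl.
  - exact: b0.
  - by apply: le_trans hm; rewrite lerDr sqr_ge0.
  - by rewrite divr_ge0// ltW.
  - rewrite (_ : (y u / N) ^+ 2 + _ = (y u ^+ 2 + (z u - r) ^+ 2) / N ^+ 2);
      last by field; rewrite gt_eqF.
    rewrite (_ : _ * _ + _ / _ = (Num.max 1 b * r ^+ 2 + q u) / N ^+ 2);
      last by field; rewrite gt_eqF.
    rewrite ler_pM2r ?invr_gt0//.
    exact: hQ (ltW t0u).
set E := k * dx ^+ 2 + dy ^+ 2 + dz ^+ 2 in Hform *.
set fm := _ - b * dz ^+ 2 in Hform *.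
set dP := A * _ + B * _ in Hform *.
have kal : 0 <= k / al * (al * dx - F1) ^+ 2.
  by rewrite mulr_ge0 ?sqr_ge0// divr_ge0// ltW.
have al2 : 0 <= al^-1 * (al * dy - F2) ^+ 2.
  by rewrite mulr_ge0 ?sqr_ge0// invr_ge0 ltW.
have al3 : 0 <= al^-1 * (al * dz + F3) ^+ 2.
  by rewrite mulr_ge0 ?sqr_ge0// invr_ge0 ltW.
have hFal : al^-1 * (k * F1 ^+ 2 + F2 ^+ 2 + F3 ^+ 2) <= S / al.
  by rewrite mulrC ler_pM2r ?invr_gt0.
(* Young's inequality spends half of the rate [2 * al] on the forcing; the other half is the rate
   that remains. *)
have hforc : 2 * (k * F1 * dx + F2 * dy - F3 * dz) <= al * E + S / al.
  apply: le_trans (lerD (lexx _) hFal).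
  rewrite -subr_ge0.
  rewrite (_ : _ - _ = k / al * (al * dx - F1) ^+ 2 + al^-1 * (al * dy - F2) ^+ 2
    + al^-1 * (al * dz + F3) ^+ 2); first by rewrite !addr_ge0.
  by rewrite /E; field; rewrite gt_eqF.
have eP0 := expR_gt0 (P u).
have ePP : expR (P u) <= expR Pmax by rewrite ler_expR.
have hSe : expR (P u) * (S / al) <= expR Pmax * (S / al).
  by rewrite ler_wpM2r// divr_ge0// ltW.
apply: le_trans (lerD (lexx _) hSe).
rewrite -[A * _ + B * _]/(P u).
rewrite (_ : _ + E * _ = expR (P u) *
  (2 * (fm + (k * F1 * dx + F2 * dy - F3 * dz)) + E * dP)); last by ring.
rewrite (_ : - al * _ + _ = expR (P u) * (- al * E + S / al)); last by ring.
rewrite ler_pM2l//.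
lra.
Qed.

(** A box of parameters on which the constants below are uniform, together with the part of the
    condition on [mu] that does not involve [K]. *)
Definition admissible (mu s0 s1 r1 b0 b1 s r b : R) :=
  [/\ s0 <= s <= s1, 0 <= r <= r1, b0 <= b <= b1 &
      (s + r) ^+ 2 + 4^-1 <= s + mu].

(** [y] and [z] are bounded by their own energy, and [x] by relaxation towards them and the
    observation. The factor 16 in [B1] bounds [((s + mu) ^+ 2)^-1], since [4^-1 <= s + mu]. *)
Lemma nudged_flow_bounded (t0 mu K s0 s1 r1 b0 b1 : R) O (X0 Y0 Z0 : R) :
  0 < s0 -> 0 < b0 -> (forall t, t0 < t -> `|O t| <= K) ->
  exists2 B, 0 <= B & forall s r b x y z,
    admissible mu s0 s1 r1 b0 b1 s r b -> nudged_flow t0 mu O s r b x y z ->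
    x t0 = X0 -> y t0 = Y0 -> z t0 = Z0 ->
    forall t, t0 <= t -> [/\ x t ^+ 2 <= B, y t ^+ 2 <= B & z t ^+ 2 <= B].
Proof.
move=> s00 b00 hO.
pose B2 := Num.max 1 b1 * r1 ^+ 2 + (Y0 ^+ 2 + 2 * Z0 ^+ 2 + 2 * r1 ^+ 2).
pose A := 2 * s1 ^+ 2 * B2 + 2 * mu ^+ 2 * K ^+ 2.
pose B1 := X0 ^+ 2 + 16 * A.
have m10 : 0 <= Num.max 1 b1 by rewrite le_max ler01.
have r120 := sqr_ge0 r1.
have B20 : 0 <= B2.
  rewrite addr_ge0 ?(mulr_ge0 m10)//; have := sqr_ge0 Y0; have := sqr_ge0 Z0; lra.
have A0 : 0 <= A by rewrite !(sqr_ge0, mulr_ge0, addr_ge0).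
have B10 : 0 <= B1 by rewrite addr_ge0 ?sqr_ge0// mulr_ge0.
exists (B1 + (2 * B2 + 2 * r1 ^+ 2)); first by lra.
move=> s r b x y z [/andP[s0s ss1] /andP[r0 rr1] /andP[b0b bb1] hm] hX ex ey ez.
have sp : 0 < s := lt_le_trans s00 s0s.
have bp : 0 < b := lt_le_trans b00 b0b.
have M4 : 4^-1 <= s + mu by apply: le_trans hm; rewrite lerDr sqr_ge0.
have M0 : 0 < s + mu by apply: lt_le_trans M4; rewrite invr_gt0.
have rr : r ^+ 2 <= r1 ^+ 2 by rewrite ler_sqr ?nnegrE// (le_trans r0).
have yz t : t0 <= t -> y t ^+ 2 + (z t - r) ^+ 2 <= B2.
  move=> t0t; apply: le_trans (energy_yz_le bp hX t0t) _.
  apply: lerD.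
    apply: ler_pM => //; rewrite ?sqr_ge0//; first by rewrite le_max ler01.
    by rewrite ge_max !le_max lexx bb1 orbT.
  apply: (@le_trans _ _ (y t0 ^+ 2 + (z t0 - r) ^+ 2)).
    by rewrite ler_piMr ?addr_ge0 ?sqr_ge0// expR_decay_le1// ltW// min1_gt0.
  rewrite ey ez; have := sqr_ge0 (Z0 + r); lra.
have y2 t : t0 <= t -> y t ^+ 2 <= B2.
  by move=> t0t; apply: le_trans (yz _ t0t); rewrite lerDl sqr_ge0.
have z2 t : t0 <= t -> z t ^+ 2 <= 2 * B2 + 2 * r1 ^+ 2.
  move=> t0t; have h := yz _ t0t; have h1 := sqr_ge0 (y t).
  have h2 := sqr_ge0 (z t - 2 * r); nra.
have x2 t : t0 <= t -> x t ^+ 2 <= B1.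
  move=> t0t; apply: le_trans (observed_coordinate_le M0 hX (A := A) _ t0t) _.
    move=> u t0u; have yB := y2 _ (ltW t0u).

    have OK : O u ^+ 2 <= K ^+ 2.
      rewrite -(real_normK (num_real (O u))) ler_sqr ?nnegrE//.
        exact: hO.
      exact: le_trans (hO u t0u).
    have := sqr_ge0 (s * y u - mu * O u).
    have s2 : s ^+ 2 <= s1 ^+ 2 by rewrite ler_sqr ?nnegrE// ltW// (lt_le_trans sp).
    have : s ^+ 2 * y u ^+ 2 <= s1 ^+ 2 * B2 by rewrite ler_pM ?sqr_ge0.
    have : mu ^+ 2 * O u ^+ 2 <= mu ^+ 2 * K ^+ 2 by rewrite ler_wpM2l ?sqr_ge0.
    rewrite /A; lra.
  rewrite ex lerD2l [leRHS]mulrC ler_wpM2l//.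
  rewrite -[leRHS]invrK lef_pV2 ?posrE ?invr_gt0 ?exprn_gt0//.
  have : 0 <= (s + mu - 4^-1) * (s + mu + 4^-1) by rewrite mulr_ge0; lra.
  lra.
move=> t t0t; have := x2 _ t0t; have := y2 _ t0t; have := z2 _ t0t.
by split; lra.
Qed.

(** Both solutions start from the same point, so the weighted energy of the difference starts at 0
    and stays below its forcing, the squared parameter increment times a bound on the second
    solution. [M] is fixed before the parameters and the time. *)
Lemma nudged_lipschitz (t0 mu K s0 s1 r1 b0 b1 : R) O (X0 Y0 Z0 : R) :
  0 < s0 -> 0 < b0 -> (forall t, t0 < t -> `|O t| <= K) ->
  exists2 M, 0 <= M & forall s r b x y z s' r' b' x' y' z',
    admissible mu s0 s1 r1 b0 b1 s r b -> nudged_flow t0 mu O s r b x y z ->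
    x t0 = X0 -> y t0 = Y0 -> z t0 = Z0 ->
    admissible mu s0 s1 r1 b0 b1 s' r' b' ->
    nudged_flow t0 mu O s' r' b' x' y' z' ->
    x' t0 = X0 -> y' t0 = Y0 -> z' t0 = Z0 ->
    forall t, t0 <= t -> (x' t - x t) ^+ 2 <=
      M * ((s' - s) ^+ 2 + (r' - r) ^+ 2 + (b' - b) ^+ 2).
Proof.
move=> s00 b00 hO.
have [B B0 hB] := @nudged_flow_bounded t0 mu K s0 s1 r1 b0 b1 O X0 Y0 Z0 s00 b00 hO.
pose q1 := Y0 ^+ 2 + 2 * Z0 ^+ 2 + 2 * r1 ^+ 2.
pose m0 := Num.min 1 b0.
pose a1 := 5 / 4 * (Num.max 1 b1 * r1 ^+ 2 + q1) + 5 / m0 * q1.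
pose k1 := `|s1 + mu| / s0 ^+ 2.
pose M := 4 * s1 ^+ 2 * (expR a1 * ((4 * k1 + 1) * B) / (3 / 100 * m0) ^+ 2).
have m00 : 0 < m0 := min1_gt0 b00.
have k10 : 0 <= k1 by rewrite divr_ge0 ?sqr_ge0.
have q10 : 0 <= q1.
  by have := sqr_ge0 Y0; have := sqr_ge0 Z0; have := sqr_ge0 r1; rewrite /q1; lra.
exists M.
  rewrite !(sqr_ge0, expR_ge0, invr_ge0, mulr_ge0)//; lra.
move=> s r b x y z s' r' b' x' y' z' hA hX ex ey ez hA' hX' ex' ey' ez' t t0t.
have hB' := hB _ _ _ _ _ _ hA' hX' ex' ey' ez'.
case: hA => [/andP[s0s ss1] /andP[r0 rr1] /andP[b0b bb1] hm].
have sp : 0 < s := lt_le_trans s00 s0s.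
have bp : 0 < b := lt_le_trans b00 b0b.
have M4 : 4^-1 <= s + mu by apply: le_trans hm; rewrite lerDr sqr_ge0.
have M0 : 0 < s + mu by apply: lt_le_trans M4; rewrite invr_gt0.
have rr : r ^+ 2 <= r1 ^+ 2 by rewrite ler_sqr ?nnegrE// (le_trans r0).
set k := (s + mu) / s ^+ 2.
have k0 : 0 < k by rewrite divr_gt0// exprn_gt0.
have kk1 : k <= k1.
  rewrite ler_pM ?invr_ge0 ?sqr_ge0 ?(ltW M0)//.
    by apply: le_trans (ler_norm _); rewrite lerD2r.
  by rewrite lef_pV2 ?posrE ?exprn_gt0// ler_sqr ?nnegrE// ltW.
(* As [s + mu] is at least 1/4, the weight [k] cannot degenerate and the energy controls the first
   component. *)
have k4 : 1 <= 4 * s1 ^+ 2 * k.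
  have h : s ^+ 2 <= s1 ^+ 2 by rewrite ler_sqr ?nnegrE// ltW// (lt_le_trans sp).
  rewrite /k mulrA ler_pdivlMr ?exprn_gt0// mul1r.
  have : 0 <= s1 ^+ 2 * (s + mu - 4^-1) by rewrite mulr_ge0 ?sqr_ge0// subr_ge0.
  lra.
set d := (s' - s) ^+ 2 + (r' - r) ^+ 2 + (b' - b) ^+ 2.
have d0 : 0 <= d by rewrite !addr_ge0 ?sqr_ge0.
have := @energy_difference_le t0 mu O s r b x y z s' r' b' x' y' z'
  ((4 * k1 + 1) * B * d) sp r0 bp hm hX hX'.
rewrite ex ey ez ex' ey' ez' -/k => /(_ erefl erefl erefl) H.
have {}H := H _ t t0t.
have dE : (x' t - x t) ^+ 2 <= 4 * s1 ^+ 2 *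
    (k * (x' t - x t) ^+ 2 + (y' t - y t) ^+ 2 + (z' t - z t) ^+ 2).
  rewrite -addrA mulrDr mulrA.
  rewrite (@le_trans _ _ (4 * s1 ^+ 2 * k * (x' t - x t) ^+ 2))//.
    by rewrite ler_peMl ?sqr_ge0.
  by rewrite lerDl !(sqr_ge0, mulr_ge0, addr_ge0).
have s120 : 0 <= 4 * s1 ^+ 2 by apply: mulr_ge0; rewrite ?sqr_ge0.
apply: le_trans dE _; rewrite /M -!(mulrA (4 * _)) ler_wpM2l//.
have Q1 : Y0 ^+ 2 + (Z0 - r) ^+ 2 <= q1.
  rewrite /q1; have := sqr_ge0 (Z0 + r); lra.
have Q0 : 0 <= Y0 ^+ 2 + (Z0 - r) ^+ 2 by rewrite addr_ge0 ?sqr_ge0.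
have mm : m0 <= Num.min 1 b by rewrite le_min !ge_min lexx b0b orbT.
have mp : 0 < Num.min 1 b := min1_gt0 bp.
apply: le_trans (H _) _.
  move=> u t0u; have [xB yB zB] := hB' _ (ltW t0u).
  rewrite !exprMn.
  have h1 : (y' u - x' u) ^+ 2 <= 4 * B by have := sqr_ge0 (y' u + x' u); lra.
  have g1 : k * ((s' - s) ^+ 2 * (y' u - x' u) ^+ 2) <= k1 * ((s' - s) ^+ 2 * (4 * B)).
    apply: ler_pM => //; first exact: ltW.
      by apply: mulr_ge0; rewrite sqr_ge0.
    by rewrite ler_wpM2l ?sqr_ge0.
  have g2 : (r' - r) ^+ 2 * x' u ^+ 2 <= (r' - r) ^+ 2 * B by rewrite ler_wpM2l ?sqr_ge0.
  have g3 : (b' - b) ^+ 2 * z' u ^+ 2 <= (b' - b) ^+ 2 * B by rewrite ler_wpM2l ?sqr_ge0.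
  have g4 : 0 <= k1 * B * ((r' - r) ^+ 2 + (b' - b) ^+ 2).
    by apply: mulr_ge0; [exact: mulr_ge0|rewrite addr_ge0 ?sqr_ge0].
  have g5 : 0 <= B * (s' - s) ^+ 2 by apply: mulr_ge0; rewrite ?sqr_ge0.
  rewrite /d; lra.
rewrite [leRHS]mulrAC -(mulrA (expR a1)).
have D0 : 0 <= (4 * k1 + 1) * B * d by rewrite !mulr_ge0//; lra.
have e1 : expR (5 / 4 * (Num.max 1 b * r ^+ 2 + (Y0 ^+ 2 + (Z0 - r) ^+ 2)) +
    5 / Num.min 1 b * (Y0 ^+ 2 + (Z0 - r) ^+ 2)) <= expR a1.
  rewrite ler_expR lerD//.
    rewrite ler_wpM2l// lerD//; apply: ler_pM => //; rewrite ?sqr_ge0//.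
      by rewrite le_max ler01.
    by rewrite ge_max !le_max lexx bb1 orbT.
  apply: ler_pM => //; first by rewrite divr_ge0// ltW.
  by rewrite ler_pM2l// lef_pV2.
have e2 : ((3 / 100 * Num.min 1 b) ^+ 2)^-1 <= ((3 / 100 * m0) ^+ 2)^-1.
  have p0 : 0 < 3 / 100 * m0 by apply: mulr_gt0 => //; rewrite divr_gt0.
  have p1 : 0 < 3 / 100 * Num.min 1 b by apply: mulr_gt0 => //; rewrite divr_gt0.
  rewrite lef_pV2 ?posrE ?exprn_gt0// ler_sqr ?nnegrE ?(ltW p0) ?(ltW p1)//.
  by rewrite ler_wpM2l.
apply: ler_pM => //; first by apply: mulr_ge0; rewrite ?expR_ge0.
  by rewrite invr_ge0 sqr_ge0.
exact: ler_wpM2r.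
Qed.

End nudged_lipschitz.

(** * Contraction along a bounded reference and along a decaying solution *)

Section synchronization.
Context {R : realType}.

(** Young's inequality turns the couplings into [(s + r - z) ^+ 2 + y ^+ 2 / b] times the squared
    first difference, with [y] and [z] bounded by [K]. The damping [s + mu] dominates this with a
    margin of 1/4: half of it absorbs the forcing, the other half gives the rate. *)
Lemma synchronization (t0 mu K s r b : R) O x y z O' x' y' z' S :
  0 < K -> 0 < b -> (`|s + r| + K) ^+ 2 + K ^+ 2 / b + 4^-1 - s < mu ->
  nudged_flow t0 mu O s r b x y z ->
  (forall t, t0 < t -> x t ^+ 2 + y t ^+ 2 + z t ^+ 2 <= K ^+ 2) ->
  nudged_flow t0 mu O' s r b x' y' z' ->
  (forall t, t0 < t -> (mu * (O' t - O t)) ^+ 2 <= S) ->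
  let E t := (x' t - x t) ^+ 2 + (y' t - y t) ^+ 2 + (z' t - z t) ^+ 2 in
  forall t, t0 <= t ->
    E t <= E t0 * expR (- (Num.min 1 b / 4) * (t - t0)) + 16 * S / Num.min 1 b.
Proof.
move=> K0 b0 hmu hX hK hX' hS E t t0t.
have mb0 := min1_gt0 b0.
set c := Num.min 1 b / 4.
have c0 : 0 < c by rewrite divr_gt0.
have c4 : c <= 4^-1 by rewrite /c -[leRHS]mul1r ler_pM2r ?invr_gt0// ge_min lexx.
have cb : c <= b / 4 by rewrite ler_pM2r ?invr_gt0// ge_min lexx orbT.
have S0 : 0 <= S.
  by apply: le_trans (sqr_ge0 _) (hS (t + 1) _); rewrite (le_lt_trans t0t)// ltrDl.
have hE := energy_difference_derivative 1 hX hX'.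
have := gronwall_cst c0 hE (D := 4 * S) _ t0t.
rewrite !mul1r -/(E t) -/(E t0) => H; apply: le_trans (H _) _; last first.
  rewrite (_ : 4 * S / c = 16 * S / Num.min 1 b); last first.
    by rewrite /c; field; rewrite gt_eqF.
  rewrite lerD2r ler_wpM2r ?expR_ge0// lerBlDr lerDl.
  by rewrite divr_ge0 ?mulr_ge0// ltW.
move=> {H} u t0u; have := hK _ t0u; have := hS _ t0u.
set F := mu * _; set dx := x' u - x u; set dy := y' u - y u; set dz := z' u - z u.
move=> hF hKu; rewrite !subrr !mul0r !mul1r add0r subr0 addr0.
have z2 : z u ^+ 2 <= K ^+ 2.
  by have := sqr_ge0 (x u); have := sqr_ge0 (y u); lra.
have y2 : y u ^+ 2 <= K ^+ 2.
  by have := sqr_ge0 (x u); have := sqr_ge0 (z u); lra.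
have zK : `|z u| <= K.
  by rewrite -ler_sqr ?nnegrE ?(ltW K0)// real_normK ?num_real.
have a2 : (s + r - z u) ^+ 2 <= (`|s + r| + K) ^+ 2.
  rewrite -(real_normK (num_real (s + r - z u))) ler_sqr ?nnegrE ?addr_ge0 ?(ltW K0)//.
  by apply: le_trans (ler_normB _ _) _; rewrite lerD2l.
have M0 : (s + r - z u) ^+ 2 + y u ^+ 2 / b + 4^-1 <= s + mu.
  have : y u ^+ 2 / b <= K ^+ 2 / b by rewrite ler_pM2r ?invr_gt0.
  lra.
have g0 : 0 <= (s + mu - ((s + r - z u) ^+ 2 + y u ^+ 2 / b + 4^-1)) * dx ^+ 2.
  by rewrite mulr_ge0 ?sqr_ge0// subr_ge0.
have g1 := sqr_ge0 ((s + r - z u) * dx - dy / 2).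
have g2 : 0 <= b^-1 * (y u * dx - b / 2 * dz) ^+ 2.
  by rewrite mulr_ge0 ?sqr_ge0// invr_ge0 ltW.
have e2 : b^-1 * (y u * dx - b / 2 * dz) ^+ 2 =
    y u ^+ 2 / b * dx ^+ 2 - y u * dx * dz + b / 4 * dz ^+ 2.
  by field; rewrite gt_eqF.
have g3 := sqr_ge0 (dx - 4 * F).
have g4 : 0 <= (4^-1 - c) * dx ^+ 2 by rewrite mulr_ge0 ?sqr_ge0// subr_ge0.
have g5 : 0 <= (4^-1 - c) * dy ^+ 2 by rewrite mulr_ge0 ?sqr_ge0// subr_ge0.
have g6 : 0 <= (b / 4 - c) * dz ^+ 2 by rewrite mulr_ge0 ?sqr_ge0// subr_ge0.
have g7 := sqr_ge0 dy.
have g8 : 0 <= b * dz ^+ 2 by rewrite mulr_ge0 ?sqr_ge0// ltW.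
lra.
Qed.

(** The parameter [b] acts only through the forcing [(b' - b) * z'], which fades with [z]. [C] may
    be large: the weight with exponent [8 / c] times the decaying bound adds [- 8] times that bound
    to the rate, which absorbs the couplings through [y] and [z]. *)
Lemma beta_sensitivity_decay (t0 mu s r b c C : R) O x y z b' x' y' z' :
  0 < b -> (s + r) ^+ 2 + 4^-1 <= s + mu ->
  0 < c -> c <= Num.min 1 b / 8 -> 0 <= C ->
  nudged_flow t0 mu O s r b x y z ->
  (forall t, t0 < t -> y t ^+ 2 + z t ^+ 2 <= C * expR (- c * (t - t0))) ->
  nudged_flow t0 mu O s r b' x' y' z' -> `|b' - b| <= b / 2 ->
  x' t0 = x t0 -> y' t0 = y t0 -> z' t0 = z t0 ->
  forall t, t0 <= t -> (x' t - x t) ^+ 2 <=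
    (16 * expR (8 * C / c) / (b * Num.min 1 b) * (b' - b) ^+ 2) *
    (C * expR (- c * (t - t0))).
Proof.
move=> b0 hm c0 cb C0 hX hyz hX' hbb ex ey ez t t0t.
have mb0 := min1_gt0 b0.
set e := Num.min 1 b / 8 in cb.
have e0 : 0 < e by rewrite divr_gt0.
have e8 : e <= 8^-1 by rewrite /e -[leRHS]mul1r ler_pM2r ?invr_gt0// ge_min lexx.
have eb : e <= b / 8 by rewrite ler_pM2r ?invr_gt0// ge_min lexx orbT.
pose q u := C * expR (- c * (u - t0)).
have q0 u : 0 <= q u by rewrite mulr_ge0 ?expR_ge0.
have qC u : t0 <= u -> q u <= C.
  by move=> t0u; rewrite /q ler_piMr// expR_decay_le1// ltW.
have hE := energy_difference_derivative 1 hX hX'.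
have hf := evolvesM hE (evolves_expR (evolvesZ (8 / c) (evolves_exp_decay t0 c C))).
set D := 16 * _ / _ * _.
have De : D = 2 * expR (8 * C / c) * (b' - b) ^+ 2 / b / e.
  by rewrite /D /e; field; rewrite !gt_eqF.
have := gronwall_decay (D := 2 * expR (8 * C / c) * (b' - b) ^+ 2 / b)
  _ C0 c0 cb hf _ _ t0t.
rewrite ex ey ez !subrr expr0n/= mulr0 !addr0 mul0r -De.
set E := 1 * _ + _ + _; move=> H.
have E0 : 0 <= E by rewrite /E mul1r !addr_ge0 ?sqr_ge0.
have P0 u : 0 <= 8 / c * q u by rewrite mulr_ge0// divr_ge0// ltW.
apply: (@le_trans _ _ E); first by rewrite /E mul1r -addrA lerDl addr_ge0 ?sqr_ge0.
apply: (@le_trans _ _ (E * expR (8 / c * q t))).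
  by rewrite ler_peMr// -[leLHS]expR0 ler_expR.
apply: H => [|//|{E E0} u t0u].
  by rewrite !(sqr_ge0, expR_ge0, invr_ge0, mulr_ge0)// ltW.
rewrite -/(q u).
have := hyz _ t0u; rewrite -/(q u).
set dx := x' u - x u; set dy := y' u - y u; set dz := z' u - z u.
(* The forcing splits into the decaying [d * z] and into [d * dz], which the damping absorbs because
   [d] is at most half of [b] in absolute value. *)
have -> : z' u = z u + dz by rewrite /dz; ring.
set d := b' - b in hbb *.
move=> hq; rewrite !subrr !mul0r !mul1r mulr0 !add0r.
have yq : y u ^+ 2 <= q u by have := sqr_ge0 (z u); lra.
have zq : z u ^+ 2 <= q u by have := sqr_ge0 (y u); lra.
have g0 : 0 <= (s + mu - ((s + r) ^+ 2 + 4^-1)) * dx ^+ 2.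
  by rewrite mulr_ge0 ?sqr_ge0// subr_ge0.
have g1 := sqr_ge0 ((s + r) * dx - dy / 2).
have g2 := sqr_ge0 (dx + 8 * z u * dy).
have g3 := sqr_ge0 (dx - 8 * y u * dz).
have g4 : 0 <= (q u - z u ^+ 2) * dy ^+ 2 by rewrite mulr_ge0 ?sqr_ge0// subr_ge0.
have g5 : 0 <= (q u - y u ^+ 2) * dz ^+ 2 by rewrite mulr_ge0 ?sqr_ge0// subr_ge0.
have g6 : 0 <= b^-1 * (d * z u + b / 2 * dz) ^+ 2.
  by rewrite mulr_ge0 ?sqr_ge0// invr_ge0 ltW.
have e6 : b^-1 * (d * z u + b / 2 * dz) ^+ 2 =
    b^-1 * d ^+ 2 * z u ^+ 2 + d * z u * dz + b / 4 * dz ^+ 2.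
  by field; rewrite gt_eqF.
have g7 : b^-1 * d ^+ 2 * z u ^+ 2 <= b^-1 * d ^+ 2 * q u.
  by rewrite ler_wpM2l// mulr_ge0 ?sqr_ge0// invr_ge0 ltW.
have g8 : 0 <= (d + b / 2) * dz ^+ 2.
  by rewrite mulr_ge0 ?sqr_ge0//; move: hbb; rewrite ler_norml => /andP[]; lra.
have g9 : 0 <= (8^-1 - e) * dx ^+ 2 by rewrite mulr_ge0 ?sqr_ge0// subr_ge0.
have g10 : 0 <= (8^-1 - e) * dy ^+ 2 by rewrite mulr_ge0 ?sqr_ge0// subr_ge0.
have g11 : 0 <= (b / 8 - e) * dz ^+ 2 by rewrite mulr_ge0 ?sqr_ge0// subr_ge0.
have g12 := sqr_ge0 dy.
have g13 : 0 <= b * dz ^+ 2 by rewrite mulr_ge0 ?sqr_ge0// ltW.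
have g14 : 0 <= q u * dx ^+ 2 by rewrite mulr_ge0 ?sqr_ge0.
have eP := expR_gt0 (8 / c * q u).
have ePP : expR (8 / c * q u) <= expR (8 * C / c).
  rewrite ler_expR (_ : 8 * C / c = 8 / c * C); last by ring.
  by rewrite ler_wpM2l ?divr_ge0 ?(ltW c0)// qC// ltW.
have hfin : expR (8 / c * q u) * (2 * (b^-1 * d ^+ 2 * q u)) <=
    2 * expR (8 * C / c) * d ^+ 2 / b * q u.
  rewrite [leRHS](_ : _ = expR (8 * C / c) * (2 * (b^-1 * d ^+ 2 * q u))); last by ring.
  by rewrite ler_wpM2r// !(sqr_ge0, invr_ge0, mulr_ge0)// ltW.
apply: le_trans (lerD (lexx _) hfin).
set G := (- (s + mu) * _ + _ - _ + _ - _).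
rewrite (_ : _ + _ * (expR _ * _) = expR (8 / c * q u) *
   (2 * (G - d * (z u + dz) * dz) - 8 * q u * (dx ^+ 2 + dy ^+ 2 + dz ^+ 2)));
  last by field; rewrite gt_eqF.
rewrite (_ : - (2 * e) * _ + _ = expR (8 / c * q u) *
   (- (2 * e) * (dx ^+ 2 + dy ^+ 2 + dz ^+ 2) + 2 * (b^-1 * d ^+ 2 * q u)));
  last by ring.
rewrite ler_pM2l//.
rewrite /G.
lra.
Qed.

Lemma expR_decay_mono (t0 a c C t : R) : c <= a -> 0 <= C -> t0 <= t ->
  C * expR (- a * (t - t0)) <= C * expR (- c * (t - t0)).
Proof.
move=> ca C0 t0t; rewrite ler_wpM2l// ler_expR ler_wpM2r ?subr_ge0//.
by rewrite lerN2.
Qed.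

(** The weight [- r / s] on [x ^+ 2] cancels the products of [x] and [y]: the derivative of the
    energy is [2 * (r * x ^+ 2 - y ^+ 2 - b * z ^+ 2)]. *)
Lemma lorenz_decay (t0 mu s r b c : R) x y z :
  0 < s -> r <= 0 -> 0 < b -> c <= s -> c <= Num.min 1 b ->
  nudged_flow t0 mu x s r b x y z ->
  forall t, t0 <= t -> y t ^+ 2 + z t ^+ 2 <=
    (- r / s * x t0 ^+ 2 + y t0 ^+ 2 + z t0 ^+ 2) * expR (- c * (t - t0)).
Proof.
move=> s0 r0 b0 cs; rewrite le_min => /andP[c1 cb] [hx hy hz] t t0t.
have p0 : 0 <= - r / s by rewrite divr_ge0 ?oppr_ge0// ltW.
have hE := evolvesD (evolvesD (evolvesZ (- r / s) (evolvesX2 hx)) (evolvesX2 hy))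
  (evolvesX2 hz).
apply: le_trans (gronwall hE (c := c) _ t0t).
  by rewrite -addrA lerDr mulr_ge0 ?sqr_ge0.
move=> u t0u; rewrite subrr mulr0 addr0.
have g1 : 0 <= (- r / s) * (s - c) * x u ^+ 2.
  by rewrite mulr_ge0 ?sqr_ge0// mulr_ge0// subr_ge0.
have g2 : 0 <= (1 - c) * y u ^+ 2 by rewrite mulr_ge0 ?sqr_ge0// subr_ge0.
have g3 : 0 <= (b - c) * z u ^+ 2 by rewrite mulr_ge0 ?sqr_ge0// subr_ge0.
have g4 : 0 <= - r * x u ^+ 2 by rewrite mulr_ge0 ?sqr_ge0// oppr_ge0.
have g5 := sqr_ge0 (y u).
have g6 : 0 <= b * z u ^+ 2 by rewrite mulr_ge0 ?sqr_ge0// ltW.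
rewrite (_ : - r / s * (2 * (x u * (s * (y u - x u)))) =
  - r * (2 * (x u * (y u - x u)))); last by field; rewrite gt_eqF.
have e1 : (- r / s) * (s - c) * x u ^+ 2 = - r * x u ^+ 2 - c * (- r / s * x u ^+ 2).
  by field; rewrite gt_eqF.
lra.
Qed.

End synchronization.

(** * Quadratic means *)

Section quadratic_mean.
Context {R : realType}.
Variables (T tau : R).
Hypothesis T_gt0 : 0 < T.
Implicit Types f g h : R -> R.
Local Notation mu := (@lebesgue_measure R).
Local Notation I := (`[tau, (tau + T)%R]%classic).

Lemma measurable_window : measurable (I : set (measurableTypeR R)).
Proof. exact: measurable_itv. Qed.

Lemma lebesgue_window : mu I = T%:E.
Proof.
rewrite lebesgue_measure_itv/= lte_fin ltrDl T_gt0 -EFinB.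
by rewrite addrAC subrr add0r.
Qed.

(** The inner product behind [L2norm], as a real number: [Rintegral] gives a default value to
    infinite integrals, hence the hypotheses [in_L2] below. *)
Definition mean_prod f g : R := T^-1 * \int[mu]_(t in I) (f t * g t).

Lemma mean_sq_le_cst f B : measurable_fun I f ->
  (forall t, tau <= t -> t <= tau + T -> f t ^+ 2 <= B) -> (mean_sq T tau f <= B%:E)%E.
Proof.
move=> mf hB; have iT0 : (0 <= T^-1%:E)%E by rewrite lee_fin invr_ge0 ltW.
have -> : B%:E = (T^-1%:E * (B%:E * mu I))%E.
  by rewrite lebesgue_window -!EFinM; congr EFin; field; rewrite gt_eqF.
apply: lee_wpmul2l => //; rewrite -(integral_cst mu measurable_window).
apply: ge0_le_integral; [exact: measurable_window|..].
- by move=> t _; rewrite lee_fin sqr_ge0.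
- by apply/measurable_EFinP; exact: measurable_funX.
- exact: measurable_cst.
- by move=> t /=; rewrite in_itv/= => /andP[h1 h2]; rewrite lee_fin hB.
Qed.

Lemma integrable_sq f : in_L2 T tau f ->
  mu.-integrable I (EFin \o (fun t => f t * f t)).
Proof.
move=> [mf fin]; apply/integrableP; split.
  by apply/measurable_EFinP; exact: measurable_funM.
have -> : (\int[mu]_(x in I) `|(EFin \o (fun t => f t * f t)%R) x| =
    \int[mu]_(t in I) (f t ^+ 2)%:E)%E.
  by apply: eq_integral => t _; rewrite /= -expr2 ger0_norm ?sqr_ge0.
move: fin; rewrite /L2norm /mean_sq.
case: (\int[_]_(_ in _) _)%E => [r _||_]; [by rewrite ltry| |by rewrite ltNye].
by rewrite gt0_muley ?lte_fin ?invr_gt0// ltxx.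
Qed.

Lemma integrable_prod f g : in_L2 T tau f -> in_L2 T tau g ->
  mu.-integrable I (EFin \o (fun t => f t * g t)).
Proof.
move=> hf hg.
have h := integrableD measurable_window (integrable_sq hf) (integrable_sq hg).
apply: le_integrable h; first exact: measurable_window.
  by apply/measurable_EFinP; apply: measurable_funM; [case: hf|case: hg].
move=> t _; rewrite /= lee_fin [leRHS]ger0_norm -?expr2 ?addr_ge0 ?sqr_ge0//.
have := sqr_ge0 (f t - g t); have := sqr_ge0 (f t + g t).
by rewrite ler_norml; nra.
Qed.

Lemma mean_prodC f g : mean_prod f g = mean_prod g f.
Proof.
by rewrite /mean_prod; congr (_ * _); apply: eq_Rintegral => t _; rewrite mulrC.
Qed.

Lemma mean_prodDl f g h : in_L2 T tau f -> in_L2 T tau g -> in_L2 T tau h ->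
  mean_prod (fun t => f t + g t) h = mean_prod f h + mean_prod g h.
Proof.
move=> hf hg hh; rewrite /mean_prod -mulrDr; congr (_ * _).
rewrite -RintegralD; [|exact: measurable_window|exact: integrable_prod|
  exact: integrable_prod].
by apply: eq_Rintegral => t _; rewrite mulrDl.
Qed.

Lemma mean_prodZl a f h : in_L2 T tau f -> in_L2 T tau h ->
  mean_prod (fun t => a * f t) h = a * mean_prod f h.
Proof.
move=> hf hh; rewrite /mean_prod mulrCA; congr (_ * _).
rewrite -RintegralZl; [|exact: measurable_window|exact: integrable_prod].
by apply: eq_Rintegral => t _; rewrite mulrA.
Qed.

Lemma mean_sqE f : in_L2 T tau f -> mean_sq T tau f = (mean_prod f f)%:E.
Proof.
move=> hf; rewrite /mean_sq /mean_prod EFinM; congr (_ * _)%E.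
have hi := integrable_sq hf.
rewrite /Rintegral fineK; last exact: integrable_fin_num.
by apply: eq_integral => t _; rewrite expr2.
Qed.

Lemma L2normE f : in_L2 T tau f -> L2norm T tau f = (Num.sqrt (mean_prod f f))%:E.
Proof. by move=> hf; rewrite /L2norm mean_sqE. Qed.

Lemma mean_prod_ge0 f : 0 <= mean_prod f f.
Proof.
rewrite mulr_ge0 ?invr_ge0 ?(ltW T_gt0)//; apply: Rintegral_ge0 => t _.
by rewrite -expr2 sqr_ge0.
Qed.

Lemma mean_sq_lt_in_L2 f : measurable_fun I f -> (mean_sq T tau f < +oo)%E ->
  in_L2 T tau f.
Proof.
move=> mf h; split=> //; move: h; rewrite /L2norm.
by case: (mean_sq T tau f) => [r|//|//] _ /=; rewrite ltry.
Qed.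

Lemma integrable_in_L2 f : measurable_fun I f ->
  mu.-integrable I (EFin \o (fun t => f t * f t)) -> in_L2 T tau f.
Proof.
move=> mf hi; apply: mean_sq_lt_in_L2 => //; rewrite /mean_sq.
have -> : (\int[mu]_(t in I) (f t ^+ 2)%:E =
    \int[mu]_(t in I) (EFin \o (fun t => f t * f t)%R) t)%E.
  by apply: eq_integral => t _; rewrite /= expr2.
have := integrable_fin_num measurable_window hi.
by move=> /fineK <-; rewrite -EFinM ltry.
Qed.

Lemma in_L2D f g : in_L2 T tau f -> in_L2 T tau g -> in_L2 T tau (fun t => f t + g t).
Proof.
move=> hf hg; have mf := hf.1; have mg := hg.1.
apply: integrable_in_L2; first exact: measurable_funD.
have h := integrableD measurable_window (integrable_sq hf) (integrable_sq hg).
have h2 := integrableZl measurable_window 2 h.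
apply: le_integrable h2; first exact: measurable_window.
  by apply/measurable_EFinP; apply: measurable_funM; exact: measurable_funD.
move=> t _; rewrite /= lee_fin.
have h1 := sqr_ge0 (f t); have h3 := sqr_ge0 (g t); have h4 := sqr_ge0 (f t - g t).
rewrite [leLHS]ger0_norm; last by rewrite -expr2 sqr_ge0.
by rewrite [leRHS]ger0_norm; lra.
Qed.

Lemma in_L2Z a f : in_L2 T tau f -> in_L2 T tau (fun t => a * f t).
Proof.
move=> hf; have mf := hf.1.
have mZ : measurable_fun I (fun t => a * f t).
  by apply: measurable_funM => //; exact: measurable_cst.
apply: integrable_in_L2 => //.
have h := integrableZl measurable_window (a ^+ 2) (integrable_sq hf).
apply: le_integrable h; first exact: measurable_window.
  by apply/measurable_EFinP; exact: measurable_funM.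
by move=> t _; rewrite /= lee_fin (_ : a * f t * (a * f t) = a ^+ 2 * (f t * f t))//; ring.
Qed.

Lemma in_L2B f g : in_L2 T tau f -> in_L2 T tau g -> in_L2 T tau (fun t => f t - g t).
Proof.
move=> hf hg; have := in_L2D hf (in_L2Z (-1) hg).
by rewrite (_ : (fun t => _) = (fun t => f t - g t))//; apply/funext => t; ring.
Qed.

Lemma mean_prodBl f g h : in_L2 T tau f -> in_L2 T tau g -> in_L2 T tau h ->
  mean_prod (fun t => f t - g t) h = mean_prod f h - mean_prod g h.
Proof.
move=> hf hg hh; have := mean_prodDl hf (in_L2Z (-1) hg) hh.
rewrite mean_prodZl// mulN1r => <-.
by congr mean_prod; apply/funext => t; ring.
Qed.

(** Cauchy-Schwarz: the mean square of [a * f - b * g] is nonnegative, in particular for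
    [a = mean_prod g g] and [b = mean_prod f g]. *)
Lemma mean_prod_sqr_le f g : in_L2 T tau f -> in_L2 T tau g ->
  mean_prod f g ^+ 2 <= mean_prod f f * mean_prod g g.
Proof.
move=> hf hg.
have quad a b : 0 <= a ^+ 2 * mean_prod f f - 2 * a * b * mean_prod f g
    + b ^+ 2 * mean_prod g g.
  have hZ := in_L2Z a hf; have hZ' := in_L2Z b hg.
  have := mean_prod_ge0 (fun t => a * f t - b * g t).
  rewrite mean_prodBl//; last exact: in_L2B.
  rewrite !mean_prodZl//; try exact: in_L2B.
  rewrite ![mean_prod _ (fun t => _ - _)]mean_prodC !mean_prodBl//.
  rewrite !mean_prodZl// [mean_prod g f]mean_prodC => H.
  by apply: le_trans H _; rewrite le_eqVlt; apply/orP; left; apply/eqP; ring.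
have f0 := mean_prod_ge0 f; have g0 := mean_prod_ge0 g.
have [g1|g1] := leP (mean_prod g g) 0.
  have gE : mean_prod g g = 0 by apply/le_anti; rewrite g1 g0.
  (* At this choice the form equals [- p ^+ 2 * (q + 2)], whence [p = 0]. *)
  rewrite gE mulr0; have := quad (mean_prod f g) (mean_prod f f + 1).
  rewrite gE mulr0 addr0; set p := mean_prod f g; set q := mean_prod f f in f0 *.
  have := sqr_ge0 p; have : 0 <= p ^+ 2 * q by rewrite mulr_ge0 ?sqr_ge0.
  nra.
have := quad (mean_prod g g) (mean_prod f g).
set p := mean_prod f g; set q := mean_prod f f; set r := mean_prod g g in g1 *.
rewrite (_ : _ + _ = r * (q * r - p ^+ 2)); last by ring.
by rewrite pmulr_rge0// subr_ge0.
Qed.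

Lemma mean_prod_normr_le f g : in_L2 T tau f -> in_L2 T tau g ->
  `|mean_prod f g| <= Num.sqrt (mean_prod f f) * Num.sqrt (mean_prod g g).
Proof.
move=> hf hg; rewrite -sqrtrM ?mean_prod_ge0// -sqrtr_sqr.
by apply: ler_wsqrtr; exact: mean_prod_sqr_le.
Qed.

(** An L2 derivative is linear only almost everywhere; pairing it with a fixed function gives exact
    identities. *)
Lemma ae_eq_mean_prod f g h : in_L2 T tau f -> in_L2 T tau g -> in_L2 T tau h ->
  {ae mu, forall t, t \in `[tau, tau + T]%R -> f t = g t} -> mean_prod f h = mean_prod g h.
Proof.
move=> hf hg hh fg; rewrite /mean_prod /Rintegral; congr (_ * fine _).
apply: ae_eq_integral.
- exact: measurable_window.
- by apply/measurable_EFinP; apply: measurable_funM; [case: hf|case: hh].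
- by apply/measurable_EFinP; apply: measurable_funM; [case: hg|case: hh].
- case: fg => N [mN N0 sub]; exists N; split=> // t /= nt; apply: sub => /= fgt.
  by apply: nt => tI; rewrite fgt.
Qed.

End quadratic_mean.

(** * Increments of Lipschitz functions *)

Section limits_along_filters.
Context {R : realType} {X : choiceType} {Y : filteredType X}.
Implicit Types (f : Y -> \bar R) (F : set (set Y)).

Lemma limf_esup_lt f F c : (limf_esup f F < c)%E ->
  exists2 V, F V & forall x, V x -> (f x < c)%E.
Proof.
move=> /ereal_inf_lt[_ [V FV <-] h]; exists V => // x Vx.
by apply: le_lt_trans h; apply: ereal_sup_ubound; exists x.
Qed.

Lemma limf_esup_le f F (b : R) :
  (forall d : R, 0 < d -> exists2 V, F V & forall x, V x -> (f x <= (b + d)%:E)%E) ->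
  (limf_esup f F <= b%:E)%E.
Proof.
move=> h; apply/lee_addgt0Pr => d d0; have [V FV Vf] := h _ d0.
apply: (@le_trans _ _ (ereal_sup (f @` V))).
  by apply: ereal_inf_lbound; exists V.
by apply: ge_ereal_sup => _ [x Vx <-]; rewrite -EFinD; exact: Vf.
Qed.

Lemma limf_einf_gt f F c : (c < limf_einf f F)%E ->
  exists2 V, F V & forall x, V x -> (c < f x)%E.
Proof.
rewrite /limf_einf lteNr => /limf_esup_lt[V FV Vf]; exists V => // x Vx.
by have := Vf _ Vx; rewrite lteN2.
Qed.

Lemma limf_einf_ge f F (b : R) :
  (forall d : R, 0 < d -> exists2 V, F V & forall x, V x -> ((b - d)%:E <= f x)%E) ->
  (b%:E <= limf_einf f F)%E.
Proof.
move=> h; rewrite /limf_einf leeNr -EFinN; apply: limf_esup_le => d d0.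
have [V FV Vf] := h _ d0; exists V => // x Vx.
by rewrite leeNl -EFinN opprD opprK; exact: Vf.
Qed.

End limits_along_filters.

(** * The fundamental theorem of calculus for Lipschitz functions *)

Section lipschitz_fundamental_theorem.
Context {R : realType}.
Local Notation mu := (@lebesgue_measure R).

(** A sequence of difference quotients, as measurability of limits and dominated convergence
    require. *)
Lemma is_derive_cvg_harmonic (f : R -> R) (s l : R) : is_derive s 1 f l ->
  (fun k : nat => k.+1%:R * (f (s + k.+1%:R^-1) - f s)) @ \oo --> l.
Proof.
move=> [df <-].
have h0 : (fun k : nat => k.+1%:R^-1 : R) @ \oo --> (0 : R)^'.
  move=> A hA.
  have hk : \forall k \near \oo, harmonic k != 0 :> R -> A (harmonic k) := @cvg_harmonic R _ hA.
  change (\forall k \near \oo, A (harmonic k)).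
  by apply: filterS hk => k; apply; rewrite invr_eq0 pnatr_eq0.
have := cvg_comp _ _ h0 df.
apply: cvg_trans; apply: near_eq_cvg; near=> k.
by rewrite /= invrK /GRing.scale/= mulr1 [_ + s]addrC.
Unshelve. all: by end_near. Qed.

Lemma lebesgue_unit_itv : mu (`]0, 1[%classic : set (measurableTypeR R)) = 1%E.
Proof. by rewrite lebesgue_measure_itv/= lte01 oppr0 adde0. Qed.

Lemma integral_cst_unit_itv (c : R) :
  (\int[mu]_(x in (`]0%R, 1%R[%classic : set (measurableTypeR R))) cst c%:E x)%E = c%:E.
Proof.
pose D : set (measurableTypeR R) := `]0, 1[%classic.
have mD : measurable D by exact: measurable_itv.
rewrite -/D integral_cst// [X in (_ * X)%E](_ : _ = 1%E) ?mule1//.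
exact: lebesgue_unit_itv.
Qed.

Lemma integrable_cst_unit_itv (c : R) :
  mu.-integrable (`]0, 1[%classic : set (measurableTypeR R)) (EFin \o cst c).
Proof.
pose D : set (measurableTypeR R) := `]0, 1[%classic.
have mD : measurable D by exact: measurable_itv.
apply/integrableP; split; first by apply/measurable_EFinP; exact: measurable_cst.
rewrite -/D [ltLHS](_ : _ = \int[mu]_(x in D) cst `|c|%:E x)%E//.
by rewrite integral_cst_unit_itv ltry.
Qed.

Variables (G g : R -> R) (M : R).
Hypothesis lipG : forall s t : R, 0 <= s -> s <= 1 -> 0 <= t -> t <= 1 ->
  `|G s - G t| <= M * `|s - t|.
Hypothesis dG : forall s : R, 0 < s -> s < 1 -> is_derive s 1 G (g s).

(** Extension of [G] by constants outside the unit interval, so that difference quotients with a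
    step to the right are bounded by [M] on the whole line. *)
Let H (s : R) := G (Num.max 0 (Num.min s 1)).

Let M_ge0 : 0 <= M.
Proof.
have := @lipG 1 0; rewrite !lexx !ler01 subr0 normr1 mulr1 => /(_ isT isT isT isT).
exact: le_trans.
Qed.

Let lipH (s t : R) : `|H s - H t| <= M * `|s - t|.
Proof.
rewrite /H; set a := Num.max _ _; set b := Num.max _ _.
have a0 : 0 <= a by rewrite /a le_max lexx.
have b0 : 0 <= b by rewrite /b le_max lexx.
have a1 : a <= 1 by rewrite /a ge_max ler01 ge_min lexx orbT.
have b1 : b <= 1 by rewrite /b ge_max ler01 ge_min lexx orbT.
apply: le_trans (lipG a0 a1 b0 b1) _; rewrite ler_wpM2l//.
have max_lip (x y : R) : `|Num.max 0 x - Num.max 0 y| <= `|x - y|.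
  have := ler_norm (x - y); have := ler_norm (- (x - y)); rewrite normrN => h1 h2.
  by case: (leP 0 x) => ?; case: (leP 0 y) => ?; rewrite ler_norml;
    apply/andP; split; lra.
have min_lip (x y : R) : `|Num.min x 1 - Num.min y 1| <= `|x - y|.
  have := ler_norm (x - y); have := ler_norm (- (x - y)); rewrite normrN => h1 h2.
  by case: (leP x 1) => ?; case: (leP y 1) => ?; rewrite ler_norml;
    apply/andP; split; lra.
exact: le_trans (max_lip _ _) (min_lip _ _).
Qed.

Let contH : continuous H.
Proof.
move=> s; apply/cvgrPdist_lt => e e0; near=> t.
apply: le_lt_trans (lipH _ _) _.
have M1 : 0 < M + 1 by rewrite ltr_wpDl.
apply: (@le_lt_trans _ _ ((M + 1) * `|s - t|)); first by rewrite ler_wpM2r// lerDl.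
rewrite -ltr_pdivlMl//; near: t.
apply: cvgr_dist_lt; first exact: cvg_id.
by apply: mulr_gt0 => //; rewrite invr_gt0 ltr_wpDl.
Unshelve. all: by end_near. Qed.

Let HG (s : R) : 0 <= s -> s <= 1 -> H s = G s.
Proof. by move=> s0 s1; rewrite /H (min_idPl _)// (max_idPr _). Qed.

Let dH (s : R) : 0 < s -> s < 1 -> is_derive s 1 H (g s).
Proof.
move=> s0 s1; apply: near_eq_is_derive (dG s0 s1).
near=> t; apply/esym/HG; apply: ltW; near: t;
  [exact: lt_nbhsr|exact: lt_nbhsl].
Unshelve. all: by end_near. Qed.

Let q (k : nat) (s : R) := k.+1%:R * (H (s + k.+1%:R^-1) - H s).

Let q_le k (s : R) : `|q k s| <= M.
Proof.
rewrite /q normrM normr_nat mulrC -ler_pdivlMr ?ltr0n//.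
by apply: le_trans (lipH _ _) _; rewrite addrAC subrr add0r ger0_norm.
Qed.

Let cont_shift (f : R -> R) (d : R) : continuous f -> continuous (fun s => f (s + d)).
Proof.
move=> cf s; apply: (@continuous_comp _ _ _ (fun s => s + d) f); last exact: cf.
by apply: continuousD; [exact: cvg_id|exact: cst_continuous].
Qed.

Let cont_q k : continuous (q k).
Proof.
move=> s; rewrite /q.
apply: (@continuousM R R (fun=> k.+1%:R : R) (fun s => H (s + k.+1%:R^-1) - H s)).
  exact: cst_continuous.
by apply: continuousB; [exact: cont_shift|exact: contH].
Qed.

Let cvg_q (s : R) : 0 < s -> s < 1 -> q ^~ s @ \oo --> g s.
Proof. by move=> s0 s1; exact: is_derive_cvg_harmonic (dH s0 s1). Qed.

Let D : set (measurableTypeR R) := `]0, 1[%classic.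

Let mD : measurable D. Proof. exact: measurable_itv. Qed.

Lemma lipschitz_derive_le (s : R) : 0 < s -> s < 1 -> `|g s| <= M.
Proof.
move=> s0 s1; have h : `|q k s| @[k --> \oo] --> `|g s| by apply: cvg_norm; exact: cvg_q.
rewrite -(cvg_lim _ h)//; apply: limr_le; first by apply/cvg_ex; exists `|g s|.
by near=> k; exact: q_le.
Unshelve. all: by end_near. Qed.

Lemma lipschitz_derive_measurable : measurable_fun D g.
Proof.
apply: (@measurable_fun_cvg _ _ _ _ q) => [k|s].
  by apply: measurable_funTS; exact: continuous_measurable_fun.
by rewrite /D/= in_itv/= => /andP[s0 s1]; exact: cvg_q.
Qed.

(** The lower endpoint -1 makes 0 an interior point, where [P] then has a two-sided derivative. *)
Let P (s : R) := \int[mu]_(t in `[(- 1)%R, s]) H t.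

Let dP (s : R) : 0 <= s -> is_derive s 1 P (H s).
Proof.
move=> s0; have ss : s < s + 1 by rewrite ltrDl.
have [] := @continuous_FTC1_closed R H (- 1) s (s + 1) ss _ _ (contH (x := s)).
- apply: continuous_compact_integrable; first exact: segment_compact.
  exact: continuous_subspaceT.
- by rewrite (lt_le_trans _ s0)// oppr_lt0.
- by move=> d1 d2; exact: (DeriveDef d1 (etrans (esym (derive1E _ _)) d2)).
Qed.

(** A difference quotient of [P] is a primitive of [q k], so the integral is a difference of two
    such quotients, at 1 and at 0, which tend to [H 1] and [H 0]. *)
Let integral_q k : (\int[mu]_(s in D) (q k s)%:E =
  (k.+1%:R * (P (1 + k.+1%:R^-1) - P 1) - k.+1%:R * (P (0 + k.+1%:R^-1) - P 0))%:E)%E.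
Proof.
set d : R := k.+1%:R^-1.
have d0 : 0 < d by rewrite invr_gt0.
pose F (s : R) := k.+1%:R * (P (s + d) - P s).
have dF (s : R) : 0 <= s -> is_derive s 1 F (q k s).
  move=> s0.
  have h1 : is_derive s 1 (fun s => P (s + d)) (H (s + d)).
    have := dP (s := s + d); rewrite addr_ge0 ?(ltW d0)// => /(_ isT) h.
    have hs : is_derive s 1 (fun s => s + d) (1 : R).
      by apply: is_derive_eq; rewrite addr0.
    by apply: is_derive_eq (@is_derive1_comp R P (fun s => s + d) s _ _ h hs) _; ring.
  have h2 := dP s0.
  rewrite /F (_ : (fun s => _) = k.+1%:R *: (fun s => P (s + d) - P s)) //.
  by apply: is_derive_eq.
have contF (s : R) : 0 <= s -> {for s, continuous F}.
  move=> s0; apply: differentiable_continuous; apply/derivable1_diffP.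
  by have [] := dF _ s0.
rewrite -[_ * _ - _ * _]/(F 1 - F 0) EFinB.
rewrite -(@continuous_FTC2 R (q k) F 0 1 ltr01).
- rewrite [RHS](integral_itv_bndoo (f := EFin \o q k))//.
  apply/measurable_EFinP; apply: measurable_funTS.
  exact: continuous_measurable_fun.
- exact: continuous_subspaceT.
- split=> [s||].
  + by rewrite in_itv/= => /andP[s0 _]; have [] := dF _ (ltW s0).
  + by apply: cvg_at_right_filter; exact: contF.
  + by apply: cvg_at_left_filter; exact: contF.
- move=> s; rewrite in_itv/= => /andP[s0 _]; rewrite derive1E.
  by have [] := dF _ (ltW s0).
Qed.

(** Dominated convergence for the [q k], with the constant [M] as dominating function. *)
Lemma lipschitz_FTC : (\int[mu]_(s in D) (g s)%:E = (G 1 - G 0)%:E)%E.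
Proof.
have [_ _ h] : [/\ mu.-integrable D (EFin \o g),
    (fun k => \int[mu]_(s in D) `|(q k s)%:E - (g s)%:E|)%E @ \oo --> 0%E &
    (fun k => \int[mu]_(s in D) (q k s)%:E)%E @ \oo --> (\int[mu]_(s in D) (g s)%:E)%E].
  apply: (@dominated_convergence _ _ _ mu D mD (fun k => EFin \o q k) (EFin \o g)
    (EFin \o cst M)).
  - move=> k; apply/measurable_EFinP; apply: measurable_funTS.
    exact: continuous_measurable_fun.
  - by apply/measurable_EFinP; exact: lipschitz_derive_measurable.
  - apply: aeW => s; rewrite /D/= in_itv/= => /andP[s0 s1].
    by apply: cvg_EFin; [near=> k|exact: cvg_q].
  - exact: integrable_cst_unit_itv.
  - by apply: aeW => s k _; rewrite lee_fin q_le.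
have h1 := is_derive_cvg_harmonic (dP ler01).
have h0 := is_derive_cvg_harmonic (dP (lexx 0)).
have hq := cvgB h1 h0.
have hc : (fun k => \int[mu]_(s in D) (q k s)%:E)%E @ \oo --> (G 1 - G 0)%:E.
  rewrite (_ : (fun k => _) = (fun k : nat => (k.+1%:R * (P (1 + k.+1%:R^-1) - P 1) -
    k.+1%:R * (P (0 + k.+1%:R^-1) - P 0))%:E)); last first.
    by apply/funext => k; exact: integral_q.
  apply: cvg_EFin; first by near=> k.
  have -> : G 1 - G 0 = H 1 - H 0 by rewrite !HG.
  exact: hq.
exact: (@cvg_unique _ (@ereal_hausdorff R) _ _ _ _ h hc).
Unshelve. all: by end_near. Qed.

End lipschitz_fundamental_theorem.

(* Fatou's lemma, and the fundamental theorem of calculus for Lipschitz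
   functions. *)
Lemma lipschitz_increment_liminf {R : realType} (G g : nat -> R -> R) (M c : R) :
  (forall n (s t : R), 0 <= s -> s <= 1 -> 0 <= t -> t <= 1 ->
     `|G n s - G n t| <= M * `|s - t|) ->
  (forall n (s : R), 0 < s -> s < 1 -> is_derive s 1 (G n) (g n s)) ->
  (forall s e : R, 0 < s -> s < 1 -> 0 < e -> \forall n \near \oo, c - e <= g n s) ->
  forall e, 0 < e -> \forall n \near \oo, c - e <= G n 1 - G n 0.
Proof.
move=> lipG dG hc e e0.
pose D : set (measurableTypeR R) := `]0, 1[%classic.
have mD : measurable D by exact: measurable_itv.
have mg n : measurable_fun D (g n).
  exact: (lipschitz_derive_measurable (lipG n) (dG n)).
have gM n (s : R) : 0 < s -> s < 1 -> `|g n s| <= M.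
  exact: (lipschitz_derive_le (lipG n) (dG n)).
have M0 : 0 <= M.
  have := gM 0%N 2^-1; rewrite invr_gt0 ltr0n invf_lt1// ltr1n => /(_ isT isT).
  exact: le_trans.
(* Adding [M] makes the integrands nonnegative. *)
have := @fatou _ _ _ (@lebesgue_measure R) D mD (fun n s => (g n s + M)%:E).
have -> : (fun n => \int[lebesgue_measure]_(s in D) (g n s + M)%:E)%E =
    (fun n => (G n 1 - G n 0 + M)%:E).
  apply/funext => n.
  have ig : lebesgue_measure.-integrable D (EFin \o g n).
    apply: (@le_integrable _ _ _ _ _ mD _ (EFin \o cst M)).
    - by apply/measurable_EFinP.
    - move=> s; rewrite /D/= in_itv/= => /andP[s0 s1].
      by rewrite lee_fin (ger0_norm M0) gM.
    - exact: integrable_cst_unit_itv.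
  have := @integralD _ _ _ lebesgue_measure D mD _ _ ig (integrable_cst_unit_itv M).
  rewrite [X in _ = (_ + X)%E](_ : _ = M%:E); last exact: integral_cst_unit_itv.
  rewrite [X in _ = (X + _)%E](_ : _ = (G n 1 - G n 0)%:E); last first.
    exact: (lipschitz_FTC (lipG n) (dG n)).
  rewrite -EFinD => <-.
  by apply: eq_integral.
move=> H.
have {H} : ((c + M)%:E <= limn_einf (fun n => (G n 1 - G n 0 + M)%:E))%E.
  have hs s : D s -> 0 < s < 1 by rewrite /D/= in_itv.
  apply: le_trans (H _ _).
  - rewrite (_ : (c + M)%:E = \int[lebesgue_measure]_(s in D) cst (c + M)%:E s)%E;
      last by apply/esym; exact: integral_cst_unit_itv.
    have hlim s : D s -> ((c + M)%:E <= limn_einf (fun n => (g n s + M)%:E))%E.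
      move=> /hs/andP[s0 s1]; apply: limf_einf_ge => d d0.
      exists [set n | c - d <= g n s]; first exact: hc.
      by move=> n /= hn; rewrite lee_fin; lra.
    (* A negative [c + M] is not a nonnegative integrand; comparison with 0 is then enough. *)
    have [c0|c0] := leP 0 (c + M).
      apply: ge0_le_integral => //.
      rewrite /limn_einf; apply: (@measurableT_comp _ _ _ _ _ _ -%E) => //.
      apply: measurable_fun_limn_esup => n.
      apply: (@measurableT_comp _ _ _ _ _ _ -%E) => //; apply/measurable_EFinP.
      by apply: measurable_funD => //; exact: measurable_cst.
    rewrite [leLHS](_ : _ = (c + M)%:E); last exact: integral_cst_unit_itv.
    apply: (@le_trans _ _ 0%E); first by rewrite lee_fin ltW.
    apply: integral_ge0 => s /hs/andP[s0 s1].
    apply: limf_einf_ge => d d0; exists setT; first exact: filterT.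
    move=> n _; rewrite lee_fin; have := gM n s s0 s1; rewrite ler_norml => /andP[]; lra.
  - move=> n; apply/measurable_EFinP.
    by apply: measurable_funD => //; exact: measurable_cst.
  - move=> n s /hs/andP[s0 s1].
    by rewrite lee_fin; have := gM n s s0 s1; rewrite ler_norml => /andP[]; lra.
move=> H; have : ((c - e + M)%:E < limn_einf (fun n => (G n 1 - G n 0 + M)%:E))%E.
  by apply: lt_le_trans H; rewrite lte_fin; lra.
move=> /limf_einf_gt[V FV hV]; apply: filterS FV => n /hV.
by rewrite lte_fin; lra.
Qed.

(** * Synchronization *)

Section bridge.
Context {R : realType}.
Implicit Types (theta v : 'rV[R]_3) (X : R -> 'rV[R]_3).

Lemma enorm_ge0 v : 0 <= enorm v.
Proof. exact: sqrtr_ge0. Qed.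

Lemma sqr_enorm v : enorm v ^+ 2 = v 0 0 ^+ 2 + v 0 1 ^+ 2 + v 0 2 ^+ 2.
Proof.
rewrite sqr_sqrtr; last by apply: sumr_ge0 => i _; exact: sqr_ge0.
rewrite !big_ord_recl big_ord0 addr0 addrA.
by congr (v 0 _ ^+ 2 + v 0 _ ^+ 2 + v 0 _ ^+ 2); apply/val_inj.
Qed.

Lemma enormZ a v : enorm (a *: v) = `|a| * enorm v.
Proof.
apply/eqP; rewrite -(@eqrXn2 _ 2) ?mulr_ge0 ?enorm_ge0// exprMn !sqr_enorm !mxE.
by rewrite real_normK ?num_real//; apply/eqP; ring.
Qed.

Lemma within_continuousM (A : set R) (f g : R -> R) :
  {within A, continuous f} -> {within A, continuous g} ->
  {within A, continuous (fun t => f t * g t)}.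
Proof. by move=> cf cg u; apply: continuousM; [exact: cf|exact: cg]. Qed.

Lemma coord_within (t0 : R) X (i : 'I_3) :
  {within `[t0, +oo[, continuous X} -> {within `[t0, +oo[, continuous (fun t => X t 0 i)}.
Proof.
move=> cX; apply: (@within_continuous_comp _ _ _ _ X (fun v : 'rV[R]_3 => v 0 i)) => //.
by move=> v _; exact: coord_continuous.
Qed.

Lemma nudged_solution_flow (t0 mu : R) O theta X : nudged_solution t0 mu O theta X ->
  nudged_flow t0 mu O (sigma theta) (rho theta) (beta theta)
    (xc \o X) (yc \o X) (zc \o X).
Proof.
move=> [cX dX]; split; (split; [exact: coord_within|]) => t /dX[]//.
Qed.

Lemma lorenz_solution_flow (t0 mu : R) theta X : lorenz_solution t0 theta X ->
  nudged_flow t0 mu (xc \o X) (sigma theta) (rho theta) (beta theta)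
    (xc \o X) (yc \o X) (zc \o X).
Proof.
move=> [cX dX]; split; (split; [exact: coord_within|]) => t /dX[]//.
by move=> h _ _; rewrite /= subrr mulr0 addr0.
Qed.

Lemma flow_in_L2 (t0 T tau mu : R) O s r b x y z O' s' r' b' x' y' z' :
  0 < T -> t0 <= tau -> nudged_flow t0 mu O s r b x y z ->
  nudged_flow t0 mu O' s' r' b' x' y' z' ->
  in_L2 T tau (fun t => x t - x' t).
Proof.
move=> T0 ttau [[cx _] _ _] [[cx' _] _ _].
have cw : {within `[tau, (tau + T)%R], continuous (fun t => x t - x' t)}.
  have c0 : {within `[t0, +oo[, continuous (fun t => x t - x' t)}.
    by move=> u; apply: continuousB; [exact: cx|exact: cx'].
  apply: continuous_subspaceW c0 => u /=.
  by rewrite !in_itv/= andbT => /andP[h _]; exact: le_trans h.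
apply: integrable_in_L2 => //.
  by apply: subspace_continuous_measurable_fun => //; exact: measurable_itv.
by apply: continuous_compact_integrable; [exact: segment_compact|exact: (within_continuousM cw cw)].
Qed.

(** The inequality [1 + u <= expR u] yields the explicit threshold [t0 + C / d / c]. *)
Lemma exp_decay_near (t0 c C d : R) : 0 < c -> 0 <= C -> 0 < d ->
  \forall t \near +oo, t0 <= t /\ C * expR (- c * (t - t0)) <= d.
Proof.
move=> c0 C0 d0; have A0 : 0 <= C / d / c by rewrite !divr_ge0// ltW.
near=> t; have ht : t0 + C / d / c <= t by near: t; apply: nbhs_pinfty_ge; exact: num_real.
split; first by apply: le_trans ht; rewrite lerDl.
rewrite mulNr expRN.
have h1 : C / d <= c * (t - t0) by rewrite [leRHS]mulrC -ler_pdivrMr// lerBrDl.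
have h2 := expR_ge1Dx (c * (t - t0)).
rewrite ler_pdivrMr ?expR_gt0// mulrC -ler_pdivrMr//.
by apply: le_trans h2; apply: le_trans h1 _; rewrite lerDr.
Unshelve. all: by end_near. Qed.

Lemma pinfty_ray (P : R -> Prop) :
  (\forall t \near +oo, P t) -> exists A, forall t, A < t -> P t.
Proof. by move=> [A [_ hA]]; exists A. Qed.

Lemma ray_pinfty (A : R) : (+oo_R : set (set R)) [set t | A < t].
Proof. by exists A; split; [exact: num_real|]. Qed.

Lemma mean_sq_ge0 (T tau : R) f : 0 < T -> (0 <= mean_sq T tau f)%E.
Proof.
move=> T0; rewrite mule_ge0 ?lee_fin ?invr_ge0 ?(ltW T0)//.
by apply: integral_ge0 => t _; rewrite lee_fin sqr_ge0.
Qed.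

(** The error forces the difference of the trajectories by [mu * x * eps] and appears once more in
    the observation itself. The inequality [(a - b) ^+ 2 <= 2 * a ^+ 2 + 2 * b ^+ 2] gives the two
    terms of the constant; 32 is twice the 16 of [synchronization]. *)
Lemma contaminated_cost_le (K mu t0 T S : R) theta X X' (eps : R -> R) :
  0 < K -> 0 < T -> 0 < beta theta ->
  (`|sigma theta + rho theta| + K) ^+ 2 + K ^+ 2 / beta theta + 4^-1
    - sigma theta < mu ->
  lorenz_solution t0 theta X -> (forall t, t0 <= t -> enorm (X t) <= K) ->
  {within `[t0, +oo[, continuous eps} ->
  (forall t, t0 <= t -> `|eps t| <= S) ->
  let O := fun t => xc (X t) * (1 + eps t) in
  nudged_solution t0 mu O theta X' ->
  (limf_esup (fun tau => mean_sq T tau (fun t => (O t - xc (X' t))%R)) +oo_R <=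
   ((2 * K ^+ 2 + 32 * mu ^+ 2 * K ^+ 2 / Num.min 1 (beta theta)) * S ^+ 2)%:E)%E.
Proof.
move=> K0 T0 b0 hmu hX hK ceps heps O hX'.
have fX := lorenz_solution_flow mu hX; have fX' := nudged_solution_flow hX'.
have hK2 t : t0 <= t -> xc (X t) ^+ 2 + yc (X t) ^+ 2 + zc (X t) ^+ 2 <= K ^+ 2.
  move=> t0t; rewrite -sqr_enorm ler_sqr ?nnegrE ?enorm_ge0 ?hK//.
  exact: ltW.
have heps2 t : t0 <= t -> eps t ^+ 2 <= S ^+ 2.
  move=> t0t; rewrite -(real_normK (num_real (eps t))) ler_sqr ?nnegrE ?heps//.
  exact: le_trans (heps _ t0t).
have hx2 t : t0 <= t -> xc (X t) ^+ 2 <= K ^+ 2.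
  move=> t0t; apply: le_trans (hK2 _ t0t).
  by rewrite -addrA lerDl addr_ge0 ?sqr_ge0.
have hx2e t : t0 <= t -> xc (X t) ^+ 2 * eps t ^+ 2 <= K ^+ 2 * S ^+ 2.
  by move=> t0t; rewrite ler_pM ?sqr_ge0 ?hx2 ?heps2.
have := @synchronization R t0 mu K (sigma theta) (rho theta) (beta theta) _ _ _ _
  O _ _ _ (mu ^+ 2 * (K ^+ 2 * S ^+ 2)) K0 b0 hmu fX _ fX' _.
set m := Num.min 1 (beta theta) => H.
pose E0 := (xc (X' t0) - xc (X t0)) ^+ 2 + (yc (X' t0) - yc (X t0)) ^+ 2
  + (zc (X' t0) - zc (X t0)) ^+ 2.
have {}H t : t0 <= t -> (xc (X' t) - xc (X t)) ^+ 2 <=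
    E0 * expR (- (m / 4) * (t - t0)) + 16 * (mu ^+ 2 * (K ^+ 2 * S ^+ 2)) / m.
  move=> t0t; apply: le_trans (H _ _ t t0t).
  - by rewrite -addrA lerDl addr_ge0 ?sqr_ge0.
  - by move=> u /ltW; exact: hK2.
  - move=> u /ltW t0u; rewrite /= (_ : O u - _ = xc (X u) * eps u); last first.
      by rewrite /O/=; ring.
    by rewrite exprMn ler_wpM2l ?sqr_ge0// exprMn hx2e.
have E00 : 0 <= E0 by rewrite !addr_ge0 ?sqr_ge0.
have m0 : 0 < m := min1_gt0 b0.
have m40 : 0 < m / 4 by rewrite divr_gt0.
apply: limf_esup_le => d d0.
have d20 : 0 < d / 2 by rewrite divr_gt0.
have [A hA] := pinfty_ray (exp_decay_near t0 m40 E00 d20).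
exists [set tau | A < tau]; first exact: ray_pinfty.
move=> tau /= Atau.
have t0tau : t0 <= tau := (hA _ Atau).1.
apply: (mean_sq_le_cst T0).
  apply: subspace_continuous_measurable_fun; first exact: measurable_itv.
  have c0 : {within `[t0, +oo[, continuous (fun t => O t - xc (X' t))}.
    move=> u; apply: continuousB; last by case: fX' => -[+ _] _ _; exact.
    apply: (within_continuousM (f := xc \o X) (g := fun t => 1 + eps t)) => {}u.
      by case: fX => -[+ _] _ _; exact.
    by apply: continuousD; [exact: cst_continuous|exact: ceps].
  apply: continuous_subspaceW c0 => u /=.
  by rewrite !in_itv/= andbT => /andP[h _]; exact: le_trans h.
move=> t taut _; have Att : A < t := lt_le_trans Atau taut.
have t0t : t0 <= t := (hA _ Att).1.
have h1 := H _ t0t; have h2 := hx2e _ t0t.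
have h3 := (hA _ Att).2.
have -> : O t - xc (X' t) = xc (X t) * eps t - (xc (X' t) - xc (X t)).
  by rewrite /O; ring.
have h4 := sqr_ge0 (xc (X t) * eps t + (xc (X' t) - xc (X t))).
have -> : (2 * K ^+ 2 + 32 * mu ^+ 2 * K ^+ 2 / m) * S ^+ 2 =
  2 * (K ^+ 2 * S ^+ 2) + 2 * (16 * (mu ^+ 2 * (K ^+ 2 * S ^+ 2)) / m).
  by field; rewrite gt_eqF.
rewrite -exprMn in h2.
lra.
Qed.

(** The contaminated bound for zero error, combined with the nonnegativity of the cost. *)
Lemma exact_cost_eq0 (K mu t0 T : R) theta X X' :
  0 < K -> 0 < T -> 0 < beta theta ->
  (`|sigma theta + rho theta| + K) ^+ 2 + K ^+ 2 / beta theta + 4^-1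
    - sigma theta < mu ->
  lorenz_solution t0 theta X -> (forall t, t0 <= t -> enorm (X t) <= K) ->
  nudged_solution t0 mu (xc \o X) theta X' ->
  limf_esup (fun tau => mean_sq T tau (fun t => (xc (X t) - xc (X' t))%R)) +oo_R = 0%E.
Proof.
move=> K0 T0 b0 hmu hX hK hX'.
apply/le_anti/andP; split; last first.
  apply: limf_esup_ge0; first exact: filter_not_empty.
  by move=> tau; exact: mean_sq_ge0.
have e : (fun t => xc (X t) * (1 + (fun=> 0) t)) = xc \o X.
  by apply/funext => t; rewrite /= addr0 mulr1.
have := @contaminated_cost_le K mu t0 T 0 theta X X' (fun=> 0) K0 T0 b0 hmu hX hK.
rewrite e expr0n mulr0; apply => //.
- by move=> u; exact: cst_continuous.
- by move=> t _; rewrite normr0.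
Qed.

Lemma le_sup_norm (t0 : R) (eps : R -> R) :
  [bounded eps t | t in `[t0, +oo[] -> forall t, t0 <= t -> `|eps t| <= sup_norm t0 eps.
Proof.
move=> /= [M [_ hM]] t t0t; apply: ub_le_sup; last first.
  by exists t => //=; rewrite in_itv/= t0t.
exists (M + 1) => _ [u /= + <-]; rewrite in_itv/= andbT => t0u.
by apply: (hM (M + 1)) => //=; rewrite ?ltrDl// in_itv/= t0u.
Qed.

End bridge.

(** * Parameter recovery *)

Section rms.
Context {R : realType}.

Lemma near0_pos (P : R -> Prop) :
  (\forall c \near (0 : R), P c) -> exists2 c : R, 0 < c & P c.
Proof.
move=> /nbhs_ballP[e /= e0 he]; exists (e / 2); first by rewrite divr_gt0.
apply: he; rewrite /ball/= sub0r normrN gtr0_norm ?divr_gt0//.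
by rewrite ltr_pdivrMr// ltr_pMr// ltr1n.
Qed.

Lemma cvg_line (eta v : 'rV[R]_3) : (fun c : R => eta + c *: v) @ (0 : R) --> eta.
Proof.
have : (fun c : R => eta + c *: v) @ (0 : R) --> eta + 0 *: v.
  by apply: cvgD; [exact: cvg_cst|apply: cvgZr_tmp; exact: cvg_id].
by rewrite scale0r addr0.
Qed.

Lemma is_derive_small_o (f : R -> R) (s l : R) :
  (forall e, 0 < e ->
     \forall c \near (0 : R), `|f (s + c) - f s - c * l| <= e * `|c|) ->
  is_derive s 1 f l.
Proof.
move=> h; have hl : (fun c : R => c^-1 *: ((f \o shift s) (c *: 1) - f s)) @ 0^' --> l.
  apply/cvgrPdist_le => e e0; have := h _ e0 => he.
  near=> c; have c0 : c != 0 by near: c; exact: nbhs_dnbhs_neq.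
  have hc : `|f (s + c) - f s - c * l| <= e * `|c|.
    by near: c; exact: cvg_within he.
  rewrite /= /GRing.scale/= mulr1 (addrC c) distrC.
  rewrite (_ : _ - l = c^-1 * (f (s + c) - f s - c * l)); last by field.
  by rewrite normrM normfV mulrC ler_pdivrMr ?normr_gt0.
apply: DeriveDef; first by apply/cvg_ex; exists l.
exact: cvg_lim hl.
Unshelve. all: by end_near. Qed.

Variables (T tau : R).
Hypothesis T_gt0 : 0 < T.
Implicit Types f g : R -> R.

Definition rms f : R := Num.sqrt (mean_prod T tau f f).

Lemma rms_ge0 f : 0 <= rms f.
Proof. exact: sqrtr_ge0. Qed.

Lemma sqr_rms f : rms f ^+ 2 = mean_prod T tau f f.
Proof. by rewrite sqr_sqrtr// mean_prod_ge0. Qed.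

Lemma rms_le_cst f B : in_L2 T tau f -> 0 <= B ->
  (forall t, tau <= t -> t <= tau + T -> f t ^+ 2 <= B ^+ 2) -> rms f <= B.
Proof.
move=> hf B0 hB; rewrite -ler_sqr ?nnegrE ?rms_ge0// sqr_rms -lee_fin -mean_sqE//.
by apply: mean_sq_le_cst => //; case: hf.
Qed.

Lemma mean_prod_le_rms f g : in_L2 T tau f -> in_L2 T tau g ->
  `|mean_prod T tau f g| <= rms f * rms g.
Proof. exact: mean_prod_normr_le. Qed.

Lemma rms_triangle f g : in_L2 T tau f -> in_L2 T tau g ->
  rms f <= rms (fun t => f t - g t) + rms g.
Proof.
move=> hf hg; have hfg := in_L2B T_gt0 hf hg.
have [f0|f0] := leP (rms f) 0.
  by apply: (le_trans f0); rewrite addr_ge0 ?rms_ge0.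
rewrite -(ler_pM2r f0) -expr2 sqr_rms mulrDl.
have -> : mean_prod T tau f f =
    mean_prod T tau (fun t => f t - g t) f + mean_prod T tau g f.
  by rewrite mean_prodBl// subrK.
by rewrite lerD// (le_trans (ler_norm _))// mean_prod_le_rms.
Qed.

Lemma rmsC f g : rms (fun t => f t - g t) = rms (fun t => g t - f t).
Proof.
rewrite /rms /mean_prod; congr (Num.sqrt (_ * _)).
by apply: eq_Rintegral => t _; ring.
Qed.

Lemma L2norm_rms f : in_L2 T tau f -> L2norm T tau f = (rms f)%:E.
Proof. exact: L2normE. Qed.

Variables (U : set 'rV[R]_3) (F : 'rV[R]_3 -> R -> R) (eta : 'rV[R]_3).
Variable (L : 'rV[R]_3 -> R -> R).
Hypothesis F_L2 : forall theta, U theta -> in_L2 T tau (F theta).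
Hypothesis U_eta : U eta.
Hypothesis dF : is_L2_derivative T tau U F eta L.

Lemma mean_prod_derivativeZ a v g : in_L2 T tau g ->
  mean_prod T tau (L (a *: v)) g = a * mean_prod T tau (L v) g.
Proof.
case: dF => hL lin _ hg.
have linE b h k : mean_prod T tau (L (b *: h + k)) g =
    b * mean_prod T tau (L h) g + mean_prod T tau (L k) g.
  rewrite -mean_prodZl// -mean_prodDl//; last exact: in_L2Z.
  by apply: ae_eq_mean_prod => //; apply: in_L2D => //; exact: in_L2Z.
have L0 : mean_prod T tau (L 0) g = 0.
  have := linE 1 0 0; rewrite scaler0 addr0 mul1r => h.
  by apply: (addIr (mean_prod T tau (L 0) g)); rewrite add0r -h.
by have := linE a v 0; rewrite addr0 L0 addr0.
Qed.

(** Pairing with [g] reduces the L2 derivative to a scalar derivative along a line. The premise on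
    [U] reflects that the derivative is relative to [U]. *)
Lemma derivative_along_line v g e : in_L2 T tau g -> 0 < e ->
  \forall c \near (0 : R), U (eta + c *: v) ->
    `|mean_prod T tau (F (eta + c *: v)) g - mean_prod T tau (F eta) g
      - c * mean_prod T tau (L v) g| <= e * `|c| * rms g.
Proof.
(* The [+ 1] keeps the divisor positive when [v] is 0. *)
move=> hg e0; case: (dF) => hL _ /(_ (e / (enorm v + 1))).
have v1 : 0 < enorm v + 1 by rewrite ltr_wpDl ?enorm_ge0.
rewrite divr_gt0// => /(_ isT) near_eta.
have {}near_eta := @cvg_line eta v _ near_eta.
near=> c => Uc.
have hFc := F_L2 Uc; have hFe := F_L2 U_eta.
have hD : in_L2 T tau (fun t => F (eta + c *: v) t - F eta t - L (c *: v) t).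
  by apply: in_L2B => //; exact: in_L2B.
rewrite -mean_prod_derivativeZ// -!mean_prodBl//; last exact: in_L2B.
apply: le_trans (mean_prod_le_rms hD hg) _.
rewrite ler_wpM2r ?rms_ge0//.
have : (L2norm T tau (fun t => (F (eta + c *: v) t - F eta t
    - L (eta + c *: v - eta) t)%R) <= (e / (enorm v + 1) * enorm (eta + c *: v - eta))%:E)%E.
  by move: Uc; near: c.
rewrite (addrC eta) addrK -(addrC eta) L2norm_rms// lee_fin => h.
apply: (le_trans h); rewrite enormZ mulrCA mulrC ler_wpM2r ?normr_ge0//.
by rewrite -mulrA ler_piMr ?(ltW e0)// ler_pdivrMl// mulr1 lerDl.
Unshelve. all: by end_near. Qed.

(** The derivative is tested against [L v] itself: for a small positive [c], [c * rms (L v) ^+ 2] is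
    at most [(B + e) * c * rms (L v)]. *)
Lemma rms_derivative_le v B : 0 <= B ->
  (\forall c \near (0 : R), U (eta + c *: v)) ->
  (\forall c \near (0 : R), U (eta + c *: v) ->
     rms (fun t => F (eta + c *: v) t - F eta t) <= B * `|c|) ->
  rms (L v) <= B.
Proof.
move=> B0 hU hB; apply/ler_addgt0Pr => e e0.
have hL : in_L2 T tau (L v) by case: dF.
have [N0|N0] := leP (rms (L v)) 0.
  by apply: (le_trans N0); rewrite addr_ge0// ltW.
have hd := derivative_along_line v hL e0.
have [c c0 [Uc [/(_ Uc) hd1 /(_ Uc) hB1]]] : exists2 c : R, 0 < c &
    U (eta + c *: v) /\ ((U (eta + c *: v) ->
    `|mean_prod T tau (F (eta + c *: v)) (L v) - mean_prod T tau (F eta) (L v)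
      - c * mean_prod T tau (L v) (L v)| <= e * `|c| * rms (L v)) /\
    (U (eta + c *: v) -> rms (fun t => F (eta + c *: v) t - F eta t) <= B * `|c|)).
  by apply: near0_pos; near=> c; split; [near: c|split; near: c].
have hFc := F_L2 Uc; have hFe := F_L2 U_eta.
have := mean_prod_le_rms (in_L2B T_gt0 hFc hFe) hL; rewrite mean_prodBl// => h1.
rewrite -sqr_rms (gtr0_norm c0) in hd1; rewrite (gtr0_norm c0) in hB1.
have h2 : rms (fun t => F (eta + c *: v) t - F eta t) * rms (L v) <= B * c * rms (L v).
  by rewrite ler_pM2r.
move: hd1 h1; rewrite !ler_norml => /andP[hd1 _] /andP[_ h1].
rewrite -(ler_pM2r (mulr_gt0 c0 N0)).
lra.
Unshelve. all: by end_near. Qed.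

End rms.

(** * Sign of [rho] on the parameter set, and the error estimate *)

Section parameter_recovery.
Context {R : realType}.
Variables (K mu t0 T alpha : R) (thetas : 'rV[R]_3) (X : R -> 'rV[R]_3).
Variables (U : set 'rV[R]_3) (Xt : 'rV[R]_3 -> R -> 'rV[R]_3).
Variable DF : R -> 'rV[R]_3 -> 'rV[R]_3 -> R -> R.
Let F theta t := xc (X t) - xc (Xt theta t).

Hypothesis K_gt0 : 0 < K.
Hypothesis T_gt0 : 0 < T.
Hypothesis alpha_gt0 : 0 < alpha.
Hypothesis lorenz_X : lorenz_solution t0 thetas X.
Hypothesis X_le : forall t, t0 <= t -> enorm (X t) <= K.
Hypothesis U_nbhs : nbhs thetas U.
Hypothesis U_convex : convex_set (U : set (convex_lmodType 'rV[R]_3)).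
Hypothesis U_pos : forall theta, U theta -> 0 < sigma theta /\ 0 < beta theta.
Hypothesis mu_large : forall theta, U theta ->
  (`|sigma theta + rho theta| + K) ^+ 2 + K ^+ 2 / beta theta + 4^-1
    - sigma theta < mu.
Hypothesis Xt_nudged : nudged_family t0 mu (xc \o X) U Xt.
Hypothesis DF_derivative : forall tau eta, t0 <= tau -> U eta ->
  is_L2_derivative T tau U F eta (DF tau eta).
Hypothesis DF_lower : forall h, ((alpha * enorm h)%:E <=
  limf_einf (fun tau => L2norm T tau (DF tau thetas h)) +oo_R)%E.
Hypothesis DF_close : forall eta h, U eta ->
  (limf_esup (fun tau => L2norm T tau
     (fun t => (DF tau eta h t - DF tau thetas h t)%R)) +oo_R
   <= (alpha / 2 * enorm h)%:E)%E.

Let U_thetas : U thetas. Proof. exact: nbhs_singleton. Qed.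

Let Xt_flow theta : U theta ->
  nudged_flow t0 mu (xc \o X) (sigma theta) (rho theta) (beta theta)
    (xc \o Xt theta) (yc \o Xt theta) (zc \o Xt theta).
Proof. by move=> Ut; apply: nudged_solution_flow; exact: Xt_nudged.1. Qed.

Let Xt_init theta theta' : U theta -> U theta' -> Xt theta t0 = Xt theta' t0.
Proof. by case: Xt_nudged => _ [X0 hX0] Ut Ut'; rewrite !hX0. Qed.

Let F_L2 tau theta : t0 <= tau -> U theta -> in_L2 T tau (F theta).
Proof.
by move=> t0tau Ut; apply: flow_in_L2 (lorenz_solution_flow mu lorenz_X) (Xt_flow Ut).
Qed.

Let DF_L2 tau eta h : t0 <= tau -> U eta -> in_L2 T tau (DF tau eta h).
Proof. by move=> t0tau Ue; case: (DF_derivative t0tau Ue). Qed.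

Let mu_ge theta : U theta -> (sigma theta + rho theta) ^+ 2 + 4^-1 <= sigma theta + mu.
Proof.
move=> Ut; have [s0 b0] := U_pos Ut; have := mu_large Ut.
have : 0 <= K ^+ 2 / beta theta by rewrite divr_ge0 ?sqr_ge0// ltW.
have : (sigma theta + rho theta) ^+ 2 <= (`|sigma theta + rho theta| + K) ^+ 2.
  rewrite -[leLHS](real_normK (num_real _)) ler_sqr ?nnegrE ?addr_ge0 ?(ltW K_gt0)//.
  by rewrite lerDl ltW.
lra.
Qed.

Let DF_lower_ray h d : 0 < d -> exists A, forall tau, A < tau ->
  ((alpha * enorm h - d)%:E < L2norm T tau (DF tau thetas h))%E.
Proof.
move=> d0; have : ((alpha * enorm h - d)%:E <
    limf_einf (fun tau => L2norm T tau (DF tau thetas h)) +oo_R)%E.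
  by apply: lt_le_trans (DF_lower h); rewrite lte_fin ltrBlDr ltrDl.
by move=> /limf_einf_gt[V [A [_ hA]] hV]; exists A => tau /hA/hV.
Qed.

Let DF_close_ray eta h d : U eta -> 0 < d -> exists A, forall tau, A < tau ->
  (L2norm T tau (fun t => (DF tau eta h t - DF tau thetas h t)%R) <
   (alpha / 2 * enorm h + d)%:E)%E.
Proof.
move=> Ue d0; have : (limf_esup (fun tau => L2norm T tau
    (fun t => (DF tau eta h t - DF tau thetas h t)%R)) +oo_R <
    (alpha / 2 * enorm h + d)%:E)%E.
  by apply: le_lt_trans (DF_close h Ue) _; rewrite lte_fin ltrDl.
by move=> /limf_esup_lt[V [A [_ hA]] hV]; exists A => tau /hA/hV.
Qed.

Let e_beta : 'rV[R]_3 := delta_mx 0 2.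

Let sigmaD theta a : sigma (theta + a *: e_beta) = sigma theta.
Proof. by rewrite /sigma !mxE/= mulr0 addr0. Qed.

Let rhoD theta a : rho (theta + a *: e_beta) = rho theta.
Proof. by rewrite /rho !mxE/= mulr0 addr0. Qed.

Let betaD theta a : beta (theta + a *: e_beta) = beta theta + a.
Proof. by rewrite /beta !mxE/= mulr1. Qed.

Let enorm_e_beta : enorm e_beta = 1.
Proof.
apply/eqP; rewrite -(@eqrXn2 _ 2) ?enorm_ge0// sqr_enorm !mxE/=.
by rewrite !expr0n/= !expr1n !add0r.
Qed.

(* Otherwise the derivative in the direction of [beta] would tend to 0. *)
Lemma yz_not_decaying eta (c C : R) : U eta ->
  (\forall a \near (0 : R), U (eta + a *: e_beta)) -> 0 < c -> 0 <= C ->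
  ~ (forall t, t0 < t -> yc (Xt eta t) ^+ 2 + zc (Xt eta t) ^+ 2 <=
       C * expR (- c * (t - t0))).
Proof.
move=> Ue Uline c0 C0 hdecay; have [s0 b0] := U_pos Ue.
have mb0 := min1_gt0 b0.
(* The rate is lowered to the range of [beta_sensitivity_decay]. *)
pose c' := Num.min c (Num.min 1 (beta eta) / 8).
have c'0 : 0 < c' by rewrite lt_min c0 divr_gt0.
have hdecay' t : t0 < t -> yc (Xt eta t) ^+ 2 + zc (Xt eta t) ^+ 2 <=
    C * expR (- c' * (t - t0)).
  move=> t0t; apply: le_trans (hdecay _ t0t) _; apply: expR_decay_mono => //; last exact: ltW.
  by rewrite ge_min lexx.
pose D := 16 * expR (8 * C / c') / (beta eta * Num.min 1 (beta eta)).
have D0 : 0 <= D.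
  by rewrite divr_ge0 ?mulr_ge0 ?expR_ge0 ?(ltW b0) ?(ltW mb0).
(* The mean squares of the increments in [beta] are at most the square of [k tau] times the step, so
   [k tau], which tends to 0, bounds the derivative. *)
pose k tau := Num.sqrt (D * C * expR (- c' * (tau - t0))).
have hk tau : t0 <= tau -> rms T tau (DF tau eta e_beta) <= k tau.
  move=> t0tau; apply: (rms_derivative_le T_gt0 (fun th Uth => F_L2 t0tau Uth) Ue
    (DF_derivative t0tau Ue)) => //; first exact: sqrtr_ge0.
  near=> a => Ua.
  have ab : `|beta eta + a - beta eta| <= beta eta / 2.
    rewrite addrC addKr; near: a.
    apply/nbhs_ballP; exists (beta eta / 2) => /=; first by rewrite divr_gt0.
    by move=> a; rewrite /ball/= sub0r normrN => /ltW.
  apply: rms_le_cst => //.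
  - by apply: in_L2B => //; exact: F_L2.
  - by rewrite mulr_ge0 ?sqrtr_ge0.
  move=> t taut _; have t0t := le_trans t0tau taut.
  have := @beta_sensitivity_decay R t0 mu (sigma eta) (rho eta) (beta eta) c' C
    (xc \o X) _ _ _ (beta eta + a) (xc \o Xt (eta + a *: e_beta))
    (yc \o Xt (eta + a *: e_beta)) (zc \o Xt (eta + a *: e_beta))
    b0 (mu_ge Ue) c'0 _ C0 (Xt_flow Ue) hdecay' _ ab.
  have := Xt_flow Ua; rewrite sigmaD rhoD betaD => fa H.
  have {}H := H _ fa _ _ _ _ t0t.
  rewrite /F (_ : _ - _ = xc (Xt eta t) - xc (Xt (eta + a *: e_beta) t)); last by ring.
  rewrite -sqrrN opprB; apply: le_trans (H _ _ _ _) _.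
  - by rewrite ge_min lexx orbT.
  - by rewrite /= (Xt_init Ua Ue).
  - by rewrite /= (Xt_init Ua Ue).
  - by rewrite /= (Xt_init Ua Ue).
  rewrite -/D addrC addKr exprMn sqr_sqrtr; last by rewrite mulr_ge0 ?expR_ge0// mulr_ge0.
  rewrite real_normK ?num_real//.
  have : C * expR (- c' * (t - t0)) <= C * expR (- c' * (tau - t0)).
    rewrite ler_wpM2l// ler_expR !mulNr lerN2 ler_wpM2l ?(ltW c'0)//.
    by rewrite lerD2r.
  have Da0 : 0 <= D * a ^+ 2 by rewrite mulr_ge0 ?sqr_ge0.
  by move=> /(ler_wpM2l Da0); lra.
(* The norm at [thetas] will exceed [3 / 4 * alpha], whereas the triangle inequality leaves less
   than [alpha / 2 + alpha / 8 + alpha / 8]. *)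
have d0 : 0 < alpha / 4 by rewrite divr_gt0.
have d1 : 0 < alpha / 8 by rewrite divr_gt0.
have [A1 hA1] := DF_lower_ray e_beta d0.
have [A2 hA2] := DF_close_ray e_beta Ue d1.
have DC0 : 0 <= D * C by rewrite mulr_ge0.
have d2 : 0 < (alpha / 8) ^+ 2 by rewrite exprn_gt0.
have [A3 hA3] := pinfty_ray (exp_decay_near t0 c'0 DC0 d2).
pose tau := Num.max A1 (Num.max A2 A3) + 1.
have tau1 : A1 < tau by rewrite /tau ltr_pwDr// le_max lexx.
have tau2 : A2 < tau by rewrite /tau ltr_pwDr// !le_max lexx orbT.
have tau3 : A3 < tau by rewrite /tau ltr_pwDr// !le_max lexx !orbT.
have [t0tau h3] := hA3 _ tau3.
have L1 := DF_L2 e_beta t0tau U_thetas; have L2 := DF_L2 e_beta t0tau Ue.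
have := hA1 _ tau1; have := hA2 _ tau2.
rewrite !L2norm_rms//; last exact: in_L2B.
rewrite !lte_fin enorm_e_beta !mulr1 rmsC => h2 h1.
have h4 := rms_triangle T_gt0 L1 L2.
have h5 : rms T tau (DF tau eta e_beta) <= alpha / 8.
  apply: le_trans (hk _ t0tau) _; rewrite /k.
  by rewrite -[leRHS](ger0_norm (ltW d1)) -sqrtr_sqr ler_wsqrtr.
lra.
Unshelve. all: by end_near. Qed.

Let segment_mem a b (s : R) : U a -> U b -> 0 <= s -> s <= 1 -> U (a + s *: (b - a)).
Proof.
move=> Ua Ub s0 s1; have := U_convex (Itv01 s0 s1) (mem_set Ub) (mem_set Ua).
rewrite inE; set w := conv _ _ _.
have -> : w = s *: b + (1 - s) *: a by [].
by congr U; apply/rowP => i; rewrite !mxE; ring.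
Qed.

Let thetas_line : \forall a \near (0 : R), U (thetas + a *: e_beta).
Proof. exact: cvg_line U_nbhs. Qed.

(** For nonpositive [rho thetas] the Lorenz trajectory decays, and the nudged trajectory at [thetas]
    synchronizes with it, so its [y] and [z] decay as well. *)
Lemma rho_thetas_gt0 : 0 < rho thetas.
Proof.
rewrite ltNge; apply/negP => r0; have [s0 b0] := U_pos U_thetas.
have mb0 := min1_gt0 b0; set b := beta thetas in b0 mb0 *.
pose c := Num.min (sigma thetas) (Num.min 1 b / 4).
have c0 : 0 < c by rewrite lt_min s0 divr_gt0.
have cb4 : c <= Num.min 1 b / 4 by rewrite ge_min lexx orbT.
have cb : c <= Num.min 1 b by apply: (le_trans cb4); lra.
have cs : c <= sigma thetas by rewrite ge_min lexx.
have fX := lorenz_solution_flow mu lorenz_X.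
have hX2 t : t0 < t -> xc (X t) ^+ 2 + yc (X t) ^+ 2 + zc (X t) ^+ 2 <= K ^+ 2.
  move=> /ltW t0t; rewrite -sqr_enorm ler_sqr ?nnegrE ?enorm_ge0 ?X_le//.
  exact: ltW.
have hS t : t0 < t -> (mu * ((xc \o X) t - (xc \o X) t)) ^+ 2 <= 0.
  by rewrite subrr mulr0 expr0n.
have h1 := lorenz_decay s0 r0 b0 cs cb fX.
have h2 := synchronization K_gt0 b0 (mu_large U_thetas) fX hX2 (Xt_flow U_thetas) hS.
have {h2}h2 t : t0 <= t -> _ := h2 t.
set L0 := _ + _ + _ in h1.
pose E0 := (xc (Xt thetas t0) - xc (X t0)) ^+ 2 + (yc (Xt thetas t0) - yc (X t0)) ^+ 2
  + (zc (Xt thetas t0) - zc (X t0)) ^+ 2.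
have E00 : 0 <= E0 by rewrite !addr_ge0 ?sqr_ge0.
have L00 : 0 <= L0.
  rewrite addr_ge0 ?sqr_ge0// addr_ge0 ?sqr_ge0// mulr_ge0 ?sqr_ge0//.
  by rewrite divr_ge0 ?oppr_ge0// ltW.
(* The factors 2 come from [a ^+ 2 <= 2 * b ^+ 2 + 2 * (a - b) ^+ 2]. *)
apply: (@yz_not_decaying thetas c (2 * L0 + 2 * E0) U_thetas thetas_line c0).
  by rewrite addr_ge0// mulr_ge0.
move=> t /ltW t0t; have := h1 _ t0t; have := h2 _ t0t.
rewrite /= mulr0 mul0r addr0 -/E0 => {}h2 {}h1.
have := expR_decay_mono cb4 E00 t0t.
have := sqr_ge0 (xc (Xt thetas t) - xc (X t)).
have := sqr_ge0 (yc (Xt thetas t) - 2 * yc (X t)).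
have := sqr_ge0 (zc (Xt thetas t) - 2 * zc (X t)).
lra.
Qed.

(** Were [rho theta] negative, the segment from [thetas] to [theta] would meet [rho = 0] at some
    [eta], where the equilibrium level of the energy of [y] and [z] vanishes. Convexity makes [eta]
    inherit from [thetas] the room to move in the direction [beta]. *)
Lemma rho_ge0 theta : U theta -> 0 <= rho theta.
Proof.
move=> Ut; rewrite leNgt; apply/negP => r0; have rs := rho_thetas_gt0.
have d0 : 0 < rho thetas - rho theta by lra.
pose s := rho thetas / (rho thetas - rho theta).
have s0 : 0 <= s by rewrite divr_ge0// ltW.
have s1 : s < 1 by rewrite ltr_pdivrMr//; lra.
pose eta := thetas + s *: (theta - thetas).
have Ue : U eta by apply: segment_mem => //; exact: ltW.
have re : rho eta = 0.
  rewrite /eta /rho !mxE -/(rho theta) -/(rho thetas) /s; field.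
  by rewrite gt_eqF.
have Uline : \forall a \near (0 : R), U (eta + a *: e_beta).
  (* With [theta] fixed, a shift of [thetas] by [a / (1 - s)] shifts the point of the segment by
     [a]. *)
  have hU : \forall a \near (0 : R), U (thetas + a *: ((1 - s)^-1 *: e_beta)).
    exact: cvg_line U_nbhs.
  apply: filterS hU => a Ua.
  have := segment_mem Ua Ut s0 (ltW s1); congr U.
  apply/rowP => i; rewrite /eta !mxE; field.
  by rewrite subr_eq0 gt_eqF.
have [_ b0] := U_pos Ue.
apply: (@yz_not_decaying eta (Num.min 1 (beta eta))
  (yc (Xt eta t0) ^+ 2 + zc (Xt eta t0) ^+ 2) Ue Uline (min1_gt0 b0)).
  by rewrite addr_ge0 ?sqr_ge0.
move=> t /ltW t0t; have := energy_yz_le b0 (Xt_flow Ue) t0t.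
by rewrite re expr0n/= mulr0 add0r !subr0.
Qed.

(** On the segment [rho] is nonnegative and the parameters stay in a box where [sigma] and [beta]
    are bounded away from 0; the observation cancels from the difference. *)
Lemma F_lipschitz theta : U theta -> exists2 M, 0 <= M &
  forall s s' t, 0 <= s -> s <= 1 -> 0 <= s' -> s' <= 1 -> t0 <= t ->
  (F (thetas + s' *: (theta - thetas)) t - F (thetas + s *: (theta - thetas)) t) ^+ 2
  <= (M * `|s' - s|) ^+ 2.
Proof.
move=> Ut; have [ss0 bs0] := U_pos U_thetas; have [st0 bt0] := U_pos Ut.
pose p s := thetas + s *: (theta - thetas).
have pU s : 0 <= s -> s <= 1 -> U (p s) by move=> s0 s1; exact: segment_mem.
have hO t : t0 < t -> `|(xc \o X) t| <= K.
  move=> /ltW t0t; apply: le_trans (X_le t0t).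
  rewrite -ler_sqr ?nnegrE ?enorm_ge0// sqr_enorm real_normK ?num_real//.
  by rewrite -addrA lerDl addr_ge0 ?sqr_ge0.
pose X0 := Xt thetas t0.
have smin : 0 < Num.min (sigma thetas) (sigma theta) by rewrite lt_min ss0.
have bmin : 0 < Num.min (beta thetas) (beta theta) by rewrite lt_min bs0.
have [M M0 hM] := @nudged_lipschitz R t0 mu K
  (Num.min (sigma thetas) (sigma theta)) (Num.max (sigma thetas) (sigma theta))
  (Num.max (rho thetas) (rho theta))
  (Num.min (beta thetas) (beta theta)) (Num.max (beta thetas) (beta theta))
  (xc \o X) (xc X0) (yc X0) (zc X0) smin bmin hO.
have btw (a b s : R) : 0 <= s -> s <= 1 -> Num.min a b <= a + s * (b - a) <= Num.max a b.
  move=> s0 s1; case: (leP a b) => ab; apply/andP; split; nra.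
have adm s : 0 <= s -> s <= 1 -> admissible mu
    (Num.min (sigma thetas) (sigma theta)) (Num.max (sigma thetas) (sigma theta))
    (Num.max (rho thetas) (rho theta))
    (Num.min (beta thetas) (beta theta)) (Num.max (beta thetas) (beta theta))
    (sigma (p s)) (rho (p s)) (beta (p s)).
  move=> s0 s1; have Up := pU _ s0 s1; split; last exact: mu_ge.
  - by rewrite /p /sigma !mxE; exact: btw.
  - by rewrite rho_ge0//= /p /rho !mxE; have /andP[] := btw (rho thetas) (rho theta) _ s0 s1.
  - by rewrite /p /beta !mxE; exact: btw.
exists (Num.sqrt M * enorm (theta - thetas)).
  by rewrite mulr_ge0 ?sqrtr_ge0 ?enorm_ge0.
move=> s s' t s0 s1 s'0 s'1 t0t; rewrite -/(p s) -/(p s').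
have U1 := pU _ s0 s1; have U2 := pU _ s'0 s'1.
have := hM _ _ _ _ _ _ _ _ _ _ _ _ (adm _ s0 s1) (Xt_flow U1) _ _ _
  (adm _ s'0 s'1) (Xt_flow U2) _ _ _ t t0t.
rewrite /= (Xt_init U1 U_thetas) (Xt_init U2 U_thetas).
move=> /(_ erefl erefl erefl erefl erefl erefl) H.
rewrite /F (_ : _ - _ - _ = xc (Xt (p s) t) - xc (Xt (p s') t)); last by ring.
rewrite -sqrrN opprB; apply: le_trans H _.
rewrite !exprMn sqr_sqrtr// sqr_enorm real_normK ?num_real//.
rewrite /p /sigma /rho /beta !mxE le_eqVlt; apply/orP; left; apply/eqP; ring.
Qed.

(** Along the segment the projection has slope asymptotically at least [alpha - alpha / 2] times
    [enorm h]. It starts from a value that tends to 0, as the cost vanishes at [thetas], and ends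
    asymptotically below the root of the limiting cost. *)
Lemma parameter_error_le theta : U theta ->
  ((enorm (theta - thetas))%:E <= (2 / alpha)%:E *
    sqrte (limf_esup (fun tau => mean_sq T tau (F theta)) +oo_R))%E.
Proof.
move=> Ut; set h := theta - thetas; rewrite leNgt; apply/negP.
have a20 : 0 < 2 / alpha by rewrite divr_gt0.
case EC : (limf_esup _ _) => [r||]; last 2 first.
- by rewrite /= gt0_muley ?lte_fin// ltNge leey.
- have : (0 <= limf_esup (fun tau => mean_sq T tau (F theta)) +oo_R)%E.
    apply: limf_esup_ge0; first exact: filter_not_empty.
    by move=> tau; exact: mean_sq_ge0.
  by rewrite EC.
rewrite /= -EFinM lte_fin mulrAC ltr_pdivrMr// => hlt.
set B := alpha / 2 * enorm h.
(* [B] exceeds the root by [4 * d]: one [d] is lost in the increment and one at each endpoint, and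
   the fourth gives the contradiction. *)
pose d := (B - Num.sqrt r) / 4.
have d0 : 0 < d by rewrite /d /B; lra.
have sr0 : 0 <= Num.sqrt r := sqrtr_ge0 r.
have [A1 hA1] : exists A, forall tau, A < tau ->
    (mean_sq T tau (F theta) < ((Num.sqrt r + d) ^+ 2)%:E)%E.
  have : (limf_esup (fun tau => mean_sq T tau (F theta)) +oo_R <
      ((Num.sqrt r + d) ^+ 2)%:E)%E.
    rewrite EC lte_fin; apply: (@le_lt_trans _ _ (Num.sqrt r ^+ 2)).
      by have [r0|/ltW r0] := leP 0 r; [rewrite sqr_sqrtr|rewrite (le_trans r0)// sqr_ge0].
    by rewrite ltr_pXn2r ?nnegrE ?ltrDl// addr_ge0// ltW.
  by move=> /limf_esup_lt[V [A [_ hA]] hV]; exists A => tau /hA/hV.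
have [A0 hA0] : exists A, forall tau, A < tau ->
    (mean_sq T tau (F thetas) < (d ^+ 2)%:E)%E.
  have : (limf_esup (fun tau => mean_sq T tau (F thetas)) +oo_R < (d ^+ 2)%:E)%E.
    rewrite (exact_cost_eq0 K_gt0 T_gt0 _ (mu_large U_thetas) lorenz_X X_le) //.
    - by rewrite lte_fin exprn_gt0.
    - by case: (U_pos U_thetas).
    - exact: Xt_nudged.1.
  by move=> /limf_esup_lt[V [A [_ hA]] hV]; exists A => tau /hA/hV.
pose p (s : R) := thetas + s *: h.
have pU (s : R) : 0 <= s -> s <= 1 -> U (p s) by move=> s0 s1; exact: segment_mem.
(* Fatou's lemma needs a sequence of windows. *)
pose tau n : R := t0 + n%:R.
have t0tau n : t0 <= tau n by rewrite lerDl.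
pose phi (n : nat) := DF (tau n) thetas h.
have phi_L2 n : in_L2 T (tau n) (phi n) by exact: DF_L2.
pose N (n : nat) := rms T (tau n) (phi n).
have N0 n : 0 <= N n by exact: rms_ge0.
(* If [N n] is 0 the quotient is 0 by convention and the bound persists. *)
have pair_le n f : in_L2 T (tau n) f ->
    `|mean_prod T (tau n) f (phi n) / N n| <= rms T (tau n) f.
  move=> hf; rewrite normrM normfV (ger0_norm (N0 n)).
  have := N0 n; rewrite le_eqVlt => /predU1P[<-|Np].
    by rewrite invr0 mulr0 rms_ge0.
  by rewrite ler_pdivrMr// mean_prod_le_rms.
have [M M0 hM] := F_lipschitz Ut.
pose G (n : nat) (s : R) := mean_prod T (tau n) (F (p s)) (phi n) / N n.
pose g (n : nat) (s : R) := mean_prod T (tau n) (DF (tau n) (p s) h) (phi n) / N n.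
have := @lipschitz_increment_liminf R G g M B.
have lipG n (s t : R) : 0 <= s -> s <= 1 -> 0 <= t -> t <= 1 ->
    `|G n s - G n t| <= M * `|s - t|.
  move=> s0 s1 t'0 t1; have h1 := F_L2 (t0tau n) (pU _ s0 s1).
  have h2 := F_L2 (t0tau n) (pU _ t'0 t1).
  rewrite /G -mulrBl -mean_prodBl//.
  have h12 := in_L2B T_gt0 h1 h2.
  apply: le_trans (pair_le _ _ h12) _.
  apply: rms_le_cst => //; first by rewrite mulr_ge0.
  by move=> u tu _; apply: hM => //; exact: le_trans tu.
have dG n (s : R) : 0 < s -> s < 1 -> is_derive s 1 (G n) (g n s).
  move=> s0 s1; have Us := pU _ (ltW s0) (ltW s1).
  apply: is_derive_small_o => e e0.
  have hF th : U th -> in_L2 T (tau n) (F th) by exact: F_L2.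
  have := derivative_along_line T_gt0 hF Us
    (DF_derivative (t0tau n) Us) h (phi_L2 n) e0 => hd.
  near=> c.
  have ps : p s + c *: h = p (s + c) by rewrite /p scalerDl addrA.
  have Uc : U (p s + c *: h).
    have hc : `|c| <= Num.min s (1 - s).
      near: c; apply/nbhs_ballP; exists (Num.min s (1 - s)) => /=.
        by rewrite lt_min s0 subr_gt0.
      by move=> c; rewrite /ball/= sub0r normrN => /ltW.
    move: hc; rewrite le_min !ler_norml => /andP[/andP[c1 _] /andP[_ c2]].
    by rewrite ps; apply: pU; lra.
  have hc : `|mean_prod T (tau n) (F (p s + c *: h)) (phi n)
      - mean_prod T (tau n) (F (p s)) (phi n)
      - c * mean_prod T (tau n) (DF (tau n) (p s) h) (phi n)| <= e * `|c| * N n.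
    by move: Uc; clear ps; near: c; exact: hd.
  rewrite ps in hc.
  rewrite (_ : G n (s + c) - G n s - c * g n s =
    (mean_prod T (tau n) (F (p (s + c))) (phi n)
      - mean_prod T (tau n) (F (p s)) (phi n)
      - c * mean_prod T (tau n) (DF (tau n) (p s) h) (phi n)) / N n); last first.
    by rewrite !mulrBl mulrA.
  rewrite normrM normfV (ger0_norm (N0 n)).
  have := N0 n; rewrite le_eqVlt => /predU1P[<-|Np].
    by rewrite invr0 mulr0 mulr_ge0// ltW.
  by rewrite ler_pdivrMr.
have tau_gt A : \forall n \near \oo, A < tau n.
  near=> n; rewrite /tau -ltrBlDl; near: n; exact: nbhs_infty_gtr.
have hg (s e : R) : 0 < s -> s < 1 -> 0 < e -> \forall n \near \oo, B - e <= g n s.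
  move=> s0 s1 e0; have Us := pU _ (ltW s0) (ltW s1).
  have e20 : 0 < e / 2 by rewrite divr_gt0.
  have [A2 hA2] := DF_lower_ray h e20; have [A3 hA3] := DF_close_ray h Us e20.
  near=> n.
  have t2 : A2 < tau n by near: n; exact: tau_gt.
  have t3 : A3 < tau n by near: n; exact: tau_gt.
  have hs := DF_L2 h (t0tau n) Us.
  have hD := in_L2B T_gt0 hs (phi_L2 n).
  have := hA2 _ t2; have := hA3 _ t3.
  rewrite !L2norm_rms// !lte_fin -/(phi n) -/(N n) => h3 h2.
  (* [N n] is the projection of [phi n] on itself; the rest is bounded by the distance between the
     derivatives. *)
  have -> : g n s = mean_prod T (tau n)
      (fun t => DF (tau n) (p s) h t - phi n t) (phi n) / N n + N n.
    rewrite mean_prodBl// mulrBl -sqr_rms// -/(N n) -/(g n s) expr2.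
    have := N0 n; rewrite le_eqVlt => /predU1P[<-|Np].
      by rewrite !mul0r subr0 addr0.
    by rewrite mulfK ?gt_eqF// subrK.
  have := pair_le n _ hD; rewrite ler_norml => /andP[h4 _].
  rewrite /B; lra.
move=> /(_ lipG dG hg d d0) [n0 _ hn0].
have [n1 _ hn1] := tau_gt (Num.max A0 A1).
pose n := maxn n0 n1.
have := hn0 n (leq_maxl _ _); have := hn1 n (leq_maxr _ _).
rewrite /= gt_max => /andP[t0n t1n] /=.
have U0 := pU 0 (lexx _) ler01; have U1 := pU 1 ler01 (lexx _).
have := pair_le n _ (F_L2 (t0tau n) U1); have := pair_le n _ (F_L2 (t0tau n) U0).
rewrite -/(G n 0) -/(G n 1).
have p0 : p 0 = thetas by rewrite /p scale0r addr0.
have p1 : p 1 = theta by rewrite /p scale1r addrC subrK.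
rewrite p0 p1 !ler_norml => /andP[k1 _] /andP[_ k2].
have h0 : rms T (tau n) (F thetas) < d.
  rewrite -(@ltr_pXn2r _ 2) ?nnegrE ?rms_ge0 ?(ltW d0)// sqr_rms// -lte_fin -mean_sqE//.
    exact: hA0.
  exact: F_L2.
have h1 : rms T (tau n) (F theta) < Num.sqrt r + d.
  rewrite -(@ltr_pXn2r _ 2) ?nnegrE ?rms_ge0 ?addr_ge0 ?(ltW d0)// sqr_rms// -lte_fin -mean_sqE//.
    exact: hA1.
  exact: F_L2.
have dE : B = Num.sqrt r + 4 * d by rewrite /d; field.
lra.
Unshelve. all: by end_near. Qed.

End parameter_recovery.

Theorem theorem7 (R : realType) (K mu : R) (thetas : 'rV[R]_3) (K_gt0 : 0 < K) :
  exists CK : R,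
  forall (t0 T : R) (X : R -> 'rV[R]_3) (U : set 'rV[R]_3),
  0 < T ->
  lorenz_solution t0 thetas X ->
  (forall t, t0 <= t -> enorm (X t) <= K) ->
  nbhs thetas U ->
  convex_set (U : set (convex_lmodType 'rV[R]_3)) ->
  (forall theta, U theta -> 0 < sigma theta /\ 0 < beta theta) ->
  (forall theta, U theta ->
    (`|sigma theta + rho theta| + K) ^+ 2 + K ^+ 2 / beta theta + 4^-1
      - sigma theta < mu) ->
  [/\ (* (i) *)
      forall Xt : 'rV[R]_3 -> R -> 'rV[R]_3,
        nudged_family t0 mu (xc \o X) U Xt ->
        cost_lim T (xc \o X) Xt thetas = 0%E,
      (* (ii) *)
      forall (eps : R -> R) (Xt : 'rV[R]_3 -> R -> 'rV[R]_3),
        let O := fun t => xc (X t) * (1 + eps t) in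
        {within `[t0, +oo[, continuous eps} ->
        [bounded eps t | t in `[t0, +oo[] ->
        nudged_family t0 mu O U Xt ->
        (cost_lim T O Xt thetas <= (CK * sup_norm t0 eps ^+ 2)%:E)%E &
      (* (iii) *)
      forall (Xt : 'rV[R]_3 -> R -> 'rV[R]_3)
             (DF : R -> 'rV[R]_3 -> 'rV[R]_3 -> R -> R) (alpha : R),
        let F := fun theta t => xc (X t) - xc (Xt theta t) in
        nudged_family t0 mu (xc \o X) U Xt ->
        (forall tau eta, t0 <= tau -> U eta ->
          is_L2_derivative T tau U F eta (DF tau eta)) ->
        0 < alpha ->
        (forall h, ((alpha * enorm h)%:E <=
          limf_einf (fun tau => L2norm T tau (DF tau thetas h)) +oo_R)%E) ->
        (forall eta h, U eta ->
          (limf_esup (fun tau => L2norm T tau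
             (fun t => (DF tau eta h t - DF tau thetas h t)%R)) +oo_R
           <= (alpha / 2 * enorm h)%:E)%E) ->
        forall theta, U theta ->
          ((enorm (theta - thetas))%:E <=
             (2 / alpha)%:E * sqrte (cost_lim T (xc \o X) Xt theta))%E ].
Proof.
exists (2 * K ^+ 2 + 32 * mu ^+ 2 * K ^+ 2 / Num.min 1 (beta thetas)).
move=> t0 T X U T0 hX hK Unb Ucv Upos hmu.
have Uth : U thetas := nbhs_singleton Unb.
have [s0 b0] := Upos _ Uth.
split.
- move=> Xt [hXt _].
  exact: (exact_cost_eq0 K_gt0 T0 b0 (hmu _ Uth) hX hK (hXt _ Uth)).
- move=> eps Xt O ceps beps [hXt _].
  exact: (contaminated_cost_le K_gt0 T0 b0 (hmu _ Uth) hX hK ceps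
    (le_sup_norm beps) (hXt _ Uth)).
- move=> Xt DF alpha F hXt hDF alpha0 hlow hclose theta Ut.
  exact: (parameter_error_le K_gt0 T0 alpha0 hX hK Unb Ucv Upos hmu hXt hDF hlow
    hclose Ut).
Qed.
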